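(* Let $\mathcal{H}$ be a separable complex Hilbert space. If $T \in B(\mathcal{H})$ is a binormal operator, then $T$ is a complex symmetric operator. Moreover, this is sharp: for every integer $n \geq 3$ there exists an $n$-normal operator (on some separable complex Hilbert space) that is not a complex symmetric operator.
   Context: All operators are bounded linear operators on separable complex Hilbert spaces. A conjugation on $\mathcal{H}$ is a conjugate-linear map $C:\mathcal{H}\to\mathcal{H}$ that is isometric and involutive ($C^2=I$). An operator $T\in B(\mathcal{H})$ is $C$-symmetric if $T = CT^*C$, and complex symmetric if it is $C$-symmetric for some conjugation $C$. An operator $T$ is binormal if it is unitarily equivalent to a $2\times 2$ operator matrix $\begin{pmatrix} N_{11} & N_{12}\\ N_{21} & N_{22}\end{pmatrix}$ whose entries $N_{ij}$ are pairwise commuting normal operators; more generally $T$ is $n$-normal if it is unitarily equivalent to an $n\times n$ operator matrix whose entries are pairwise commuting normal operators. *)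

(* Defs.v *)
From HB Require Import structures.
From mathcomp Require Import all_boot all_order all_algebra.
From mathcomp Require Import reals.
From mathcomp Require Import complex.
Set Implicit Arguments. Unset Strict Implicit. Unset Printing Implicit Defensive.
Import Order.TTheory GRing.Theory Num.Theory.
Local Open Scope ring_scope.

Record hilbert (R : realType) := Hilbert {
  hcarrier :> lmodType R[i];
  hip : hcarrier -> hcarrier -> R[i];
  hip_linear : forall (a : R[i]) (x y z : hcarrier),
      hip (a *: x + y) z = a * hip x z + hip y z;
  hip_conj : forall x y : hcarrier, hip y x = Num.conj (hip x y);
  hip_ge0 : forall x : hcarrier, 0 <= hip x x;
  hip_def : forall x : hcarrier, hip x x = 0 -> x = 0;
  hcomplete : forall u : nat -> hcarrier,
      (forall e : R, 0 < e -> exists N : nat, forall m n : nat, (N <= m)%N -> (N <= n)%N ->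
         Num.sqrt (complex.Re (hip (u m - u n) (u m - u n))) < e) ->
      exists l : hcarrier, forall e : R, 0 < e -> exists N : nat, forall n : nat, (N <= n)%N ->
         Num.sqrt (complex.Re (hip (u n - l) (u n - l))) < e;
  hseparable : exists d : nat -> hcarrier, forall (x : hcarrier) (e : R), 0 < e ->
      exists k : nat, Num.sqrt (complex.Re (hip (x - d k) (x - d k))) < e
}.

Section HilbertDefs.
Variable R : realType.

Definition hnorm (H : hilbert R) (x : H) : R := Num.sqrt (complex.Re (hip x x)).

Definition is_linear_op (H K : hilbert R) (T : H -> K) :=
  forall (a : R[i]) (x y : H), T (a *: x + y) = a *: T x + T y.

Definition is_bop (H K : hilbert R) (T : H -> K) :=
  is_linear_op T /\ exists M : R, forall x : H, hnorm (T x) <= M * hnorm x.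

Definition is_adjoint (H : hilbert R) (T S : H -> H) :=
  forall x y : H, hip (T x) y = hip x (S y).

Definition is_normal (H : hilbert R) (N : H -> H) :=
  is_bop N /\ exists S : H -> H, is_adjoint N S /\ forall x, N (S x) = S (N x).

Definition is_conjugation (H : hilbert R) (C : H -> H) :=
  (forall (a : R[i]) (x y : H), C (a *: x + y) = Num.conj a *: C x + C y) /\
  (forall x : H, hnorm (C x) = hnorm x) /\
  (forall x : H, C (C x) = x).

Definition C_symmetric (H : hilbert R) (C T : H -> H) :=
  exists S : H -> H, is_adjoint T S /\ forall x, T x = C (S (C x)).

Definition complex_symmetric (H : hilbert R) (T : H -> H) :=
  exists C : H -> H, is_conjugation C /\ C_symmetric C T.

(* T is n-normal: there is a Hilbert space K, a unitary U : H -> K^(n)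
   (K^(n) = direct sum of n copies of K, represented as functions 'I_n -> K
   with inner product sum_i <u i, v i>), and an n x n matrix (N i j) of
   pairwise commuting normal operators on K with U T U^{-1} = (N i j). *)
Definition n_normal (n : nat) (H : hilbert R) (T : H -> H) :=
  exists (K : hilbert R) (U : H -> 'I_n -> K) (N : 'I_n -> 'I_n -> K -> K),
    (forall (a : R[i]) (x y : H) (i : 'I_n), U (a *: x + y) i = a *: U x i + U y i) /\
    (forall x y : H, hip x y = \sum_(i < n) hip (U x i) (U y i)) /\
    (forall v : 'I_n -> K, exists x : H, forall i, U x i = v i) /\
    (forall i j, is_normal (N i j)) /\
    (forall i j k l (z : K), N i j (N k l z) = N k l (N i j z)) /\
    (forall (x : H) (i : 'I_n), U (T x) i = \sum_(j < n) N i j (U x j)).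

Definition binormal (H : hilbert R) (T : H -> H) := n_normal 2 T.

End HilbertDefs.

(* Main.v *)
Require Import Defs.
From HB Require Import structures.
From mathcomp Require Import boolp classical_sets.
From mathcomp Require Import all_boot all_order all_algebra.
From mathcomp Require Import cyclic separable cyclotomic.
From mathcomp Require Import reals complex.
From mathcomp Require Import ring lra.
Set Implicit Arguments. Unset Strict Implicit. Unset Printing Implicit Defensive.

(* A conjugation J with J A J = A* exists for every commuting self-adjoint family of operators, by
   a decomposition into cyclic subspaces. For a 2x2 matrix T over such a family (its entries and
   their adjoints commute by Fuglede's theorem) put m = (N_ij* ). A symmetric matrix S over the
   generated algebra with S* S = s^2 and m S symmetric yields, through s a |-> J S a, a partial
   conjugation C with C T* = T C. Symmetric unitary 2x2 matrices up to a scalar are points of the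
   real 2-sphere, and symmetry of m S is orthogonality to the real and imaginary parts of a vector
   of C^3, so S can be taken as a cross product; on the joint kernels, where it degenerates,
   simpler choices of S work, and the partial conjugations glue.
   For n >= 3 the weighted shift e2 |-> 2 e1, e1 |-> e0 is not complex symmetric: comparing squares, a
   conjugation would send e2 to a multiple of e0, and so match two different weights. *)
Import Order.TTheory GRing.Theory Num.Theory.
Local Open Scope ring_scope.

(** * Inner product and norm in a Hilbert space *)

Section Hilbert.
Context {R : realType} {H : hilbert R}.
Implicit Types (a : R[i]) (x y z : H).

(** [J] turns every entry of T into its adjoint, so coordinatewise T J = J m, while T* is the
    transpose m^t. For C = J S the relation C T* = T C therefore reads S m^t = m S, and for
    symmetric S this is symmetry of m S. Over each point of a joint spectrum such a unitary S
    exists. The obstacle is that no choice is continuous in the entries: where the vector of C^3 is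
    real, it would give a field of tangent lines on the 2-sphere. Hence S is a unitary only up to a
    scalar s that may vanish, its entries are polynomials in those of m and their adjoints, and
    joint kernels stand in for pieces of the spectrum. No spectral measure occurs; the analytic
    input is Fuglede's theorem and one operator square root. S* S = s^2 makes s a |-> J S a
    isometric. Symmetry of S makes this partial map symmetric, and that yields C^2 = 1 even though
    its values need not lie in its domain. *)

Lemma hipDl x y z : hip (x + y) z = hip x z + hip y z.
Proof. by have := hip_linear 1 x y z; rewrite scale1r mul1r. Qed.

Lemma hip0l z : hip 0 z = 0 :> R[i].
Proof. by apply: (addrI (hip 0 z)); rewrite -hipDl !addr0. Qed.

Lemma hipZl a x z : hip (a *: x) z = a * hip x z.
Proof. by have := hip_linear a x 0 z; rewrite hip0l !addr0. Qed.

Lemma hipNl x z : hip (- x) z = - hip x z.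
Proof. by rewrite -scaleN1r hipZl mulN1r. Qed.

Lemma hipBl x y z : hip (x - y) z = hip x z - hip y z.
Proof. by rewrite hipDl hipNl. Qed.

Lemma hipDr x y z : hip z (x + y) = hip z x + hip z y.
Proof. by rewrite hip_conj hipDl rmorphD /= -!hip_conj. Qed.

Lemma hip0r z : hip z 0 = 0 :> R[i].
Proof. by rewrite hip_conj hip0l rmorph0. Qed.

Lemma hipZr a x z : hip z (a *: x) = a^* * hip z x.
Proof. by rewrite hip_conj hipZl rmorphM /= -hip_conj. Qed.

Lemma hipNr x z : hip z (- x) = - hip z x.
Proof. by rewrite hip_conj hipNl rmorphN /= -hip_conj. Qed.

Lemma hipBr x y z : hip z (x - y) = hip z x - hip z y.
Proof. by rewrite hipDr hipNr. Qed.

Lemma hip_inj x y : (forall z, hip x z = hip y z) -> x = y.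
Proof.
move=> E; apply/eqP; rewrite -subr_eq0; apply/eqP/hip_def.
by rewrite hipBl E subrr.
Qed.

Lemma hip_eq0 x : (forall z, hip x z = 0) -> x = 0.
Proof. by move=> E; apply: hip_def. Qed.

Lemma hnorm_ge0 x : 0 <= hnorm x.
Proof. exact: sqrtr_ge0. Qed.

Lemma hip_hnorm x : hip x x = ((hnorm x) ^+ 2)%:C%C.
Proof.
have h := hip_ge0 x; rewrite /hnorm sqr_sqrtr; last by move: h; rewrite lecE => /andP[].
by rewrite RRe_real // realE h.
Qed.

Lemma hnorm_hip x : (hnorm x)%:C%C ^+ 2 = hip x x.
Proof. by rewrite hip_hnorm -rmorphXn. Qed.

Lemma hnorm_re x : hnorm x ^+ 2 = complex.Re (hip x x).
Proof. by rewrite hip_hnorm. Qed.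

Lemma hnorm0 : hnorm (0 : H) = 0.
Proof. by rewrite /hnorm hip0l /= sqrtr0. Qed.

Lemma hnorm_eq0 x : hnorm x = 0 -> x = 0.
Proof. by move=> E; apply: hip_def; rewrite hip_hnorm E expr0n. Qed.

Lemma hnorm2E x (r : R) : 0 <= r -> hip x x = (r ^+ 2)%:C%C -> hnorm x = r.
Proof. by move=> r0 E; rewrite /hnorm E /= sqrtr_sqr ger0_norm. Qed.

Lemma hnorm_eq (x : H) (K : hilbert R) (y : K) :
  hip x x = hip y y -> hnorm x = hnorm y.
Proof. by rewrite /hnorm => ->. Qed.

Lemma hnormZ a x : (hnorm (a *: x))%:C%C = `|a| * (hnorm x)%:C%C.
Proof.
have [r Er] : exists r : R, `|a| = r%:C%C.
  by exists (complex.Re `|a|); rewrite RRe_real // normr_real.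
have r0 : 0 <= r by rewrite -ler0c -Er.
rewrite Er -rmorphM; congr (_%:C%C).
apply: hnorm2E; first by rewrite mulr_ge0 ?hnorm_ge0.
by rewrite hipZl hipZr mulrA -normCK hip_hnorm exprMn Er -rmorphXn -rmorphM.
Qed.

Lemma hnormZr (r : R) x : hnorm (r%:C%C *: x) = `|r| * hnorm x.
Proof. by apply: complexI; rewrite hnormZ normc_def /= expr0n addr0 sqrtr_sqr rmorphM. Qed.

Lemma hnormN x : hnorm (- x) = hnorm x.
Proof. by apply: hnorm_eq; rewrite hipNl hipNr opprK. Qed.

Lemma hnormBC x y : hnorm (x - y) = hnorm (y - x).
Proof. by rewrite -hnormN opprB. Qed.

Lemma hip_CS x y : `|hip x y| <= (hnorm x * hnorm y)%:C%C.
Proof.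
have [->|/eqP y0] := pselect (y = 0).
  by rewrite hip0r normr0 hnorm0 mulr0.
have n0 : 0 < hnorm y.
  rewrite lt_neqAle hnorm_ge0 andbT eq_sym.
  by apply/eqP => /hnorm_eq0 /eqP; apply/negP.
rewrite -ler_sqr ?nnegrE //; last by rewrite ler0c mulr_ge0 ?hnorm_ge0.
set q := hip y y.
have q0 : 0 < q by rewrite /q hip_hnorm ltcR exprn_gt0.
have qr : q^* = q by apply/CrealP; rewrite gtr0_real.
have := hip_ge0 (x - (hip x y / q) *: y).
rewrite !hipBl !hipBr !hipZl !hipZr -/q (hip_conj x y) rmorphM fmorphV /= qr.
set c := hip x y.
have -> : hip x x - c^* / q * c - (c / q * c^* - c / q * (c^* / q * q)) =
  hip x x - c * c^* / q by field; rewrite gt_eqF.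
rewrite -normCK subr_ge0 ler_pdivrMr // => h.
by rewrite rmorphM exprMn !hnorm_hip.
Qed.

Lemma Re_le_norm (c : R[i]) (r : R) : `|c| <= r%:C%C -> complex.Re c <= r.
Proof.
move=> h; rewrite -lecR; apply: le_trans h.
apply: le_trans (normc_ge_Re c); rewrite lecR; exact: ler_norm.
Qed.

Lemma hnormD x y : hnorm (x + y) <= hnorm x + hnorm y.
Proof.
rewrite -ler_sqr ?nnegrE ?addr_ge0 ?hnorm_ge0 //.
have E : hnorm (x + y) ^+ 2 = hnorm x ^+ 2 + hnorm y ^+ 2
   + complex.Re (hip x y) *+ 2.
  rewrite !hnorm_re hipDl !hipDr (hip_conj x y).
  by case: (hip x x) (hip x y) (hip y y) => [a b] [c d] [e f] /=; ring.
have := Re_le_norm (hip_CS x y); rewrite E => h.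
rewrite sqrrD; move: h; move: (complex.Re _) (hnorm x) (hnorm y) => r a b h.
by rewrite -[X in _ <= X]addrAC lerD2l ler_wMn2r.
Qed.

Lemma hnormB x y : hnorm (x - y) <= hnorm x + hnorm y.
Proof. by rewrite -(hnormN y); apply: hnormD. Qed.

Lemma hnorm_triB (z x y : H) : hnorm (x - y) <= hnorm (x - z) + hnorm (z - y).
Proof. by have := hnormD (x - z) (z - y); rewrite addrA subrK. Qed.

Lemma parallelogram x y :
  hnorm (x + y) ^+ 2 + hnorm (x - y) ^+ 2 = (hnorm x ^+ 2 + hnorm y ^+ 2) * 2.
Proof.
rewrite !hnorm_re hipBl !hipDl !hipBr !hipDr (hip_conj x y).
by case: (hip x x) (hip x y) (hip y y) => [a b] [c d] [e f] /=; ring.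
Qed.

Lemma hnorm_small x : (forall e : R, 0 < e -> hnorm x < e) -> x = 0.
Proof.
move=> h; apply: hnorm_eq0; apply/eqP; rewrite eq_le hnorm_ge0 andbT.
by rewrite leNgt; apply/negP => /h; rewrite ltxx.
Qed.

Lemma norm_small (c : R[i]) (M : R) :
  (forall e : R, 0 < e -> `|c| <= (M * e)%:C%C) -> c = 0.
Proof.
move=> h; apply/eqP; rewrite -normr_eq0.
have -> : `|c| = (complex.Re `|c|)%:C%C by rewrite RRe_real // normr_real.
set t := complex.Re _.
have Et e : 0 < e -> t <= M * e.
  by move=> /h h1; rewrite /t -lecR RRe_real // normr_real.
have t0 : 0 <= t by rewrite -ler0c /t RRe_real ?normr_real.
suff -> : t = 0 by [].
apply/eqP; rewrite eq_le t0 andbT leNgt; apply/negP => tp.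
have [M0|M0] := leP M 0.
  have := Et 1 ltr01; rewrite mulr1 => h1.
  by have := lt_le_trans tp (le_trans h1 M0); rewrite ltxx.
have := Et (t / (2 * M)) (divr_gt0 tp (mulr_gt0 (ltr0Sn R 1) M0)).
have -> : M * (t / (2 * M)) = t / 2 by field; rewrite gt_eqF.
by rewrite ler_pdivlMr // mulr_natr mulr2n gerDl leNgt tp.
Qed.

End Hilbert.

Lemma inv_small (R : realType) (e : R) : 0 < e -> exists n : nat, n.+1%:R^-1 < e.
Proof.
move=> e0; exists (Num.bound e^-1).
rewrite invf_plt ?posrE ?ltr0Sn //.
have := archi_boundP (_ : 0 <= e^-1); rewrite invr_ge0 ltW // => /(_ isT) h.
by rewrite -natr1; apply: lt_trans h _; rewrite ltrDl ltr01.
Qed.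

Lemma inv_mono (R : realType) (m n : nat) : (m <= n)%N -> n.+1%:R^-1 <= m.+1%:R^-1 :> R.
Proof. by move=> mn; rewrite lef_pV2 ?posrE ?ltr0Sn // ler_nat ltnS. Qed.

(** * Extending a partial conjugation to the whole space *)

Section Extension.
Context {R : realType} {H : hilbert R}.
Implicit Types (a : R[i]) (x y z w u v : H).

Lemma hcauchy (u : nat -> H) :
  (forall e : R, 0 < e -> exists N : nat, forall m n : nat, (N <= m)%N -> (N <= n)%N ->
     hnorm (u m - u n) < e) ->
  exists l : H, forall e : R, 0 < e -> exists N : nat, forall n : nat, (N <= n)%N ->
     hnorm (u n - l) < e.
Proof. exact: hcomplete. Qed.

Definition total (D : H -> Prop) := forall z, (forall x, D x -> hip x z = 0) -> z = 0.

(** The projection argument: vectors of [M] nearly minimizing the distance to [z] form a Cauchy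
    sequence by the parallelogram law, and [z] minus their limit is orthogonal to [M], hence
    zero. *)
Lemma span_dense (M : H -> Prop) :
  M 0 -> (forall a x y, M x -> M y -> M (a *: x + y)) -> total M ->
  forall z (e : R), 0 < e -> exists2 x, M x & hnorm (z - x) < e.
Proof.
move=> M0 Mlin Mtot z.
pose E : set R := fun t => exists2 x, M x & t = hnorm (z - x) ^+ 2.
have Elb : has_lbound E by exists 0 => _ [x _ ->]; rewrite exprn_ge0 ?hnorm_ge0.
have Einf : has_inf E by split=> //; exists (hnorm (z - 0) ^+ 2); exists 0.
set d := inf E.
have dle x : M x -> d <= hnorm (z - x) ^+ 2 by move=> Mx; apply: ge_inf => //; exists x.
(* Squared distances are taken within [h n ^+ 2] of the infimum, so that the Cauchy bound and the
   orthogonality defect are both linear in [h]. *)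
pose h n : R := n.+1%:R^-1.
have h0 n : 0 < h n by rewrite invr_gt0 ltr0Sn.
have /choice[u uP] : forall n, exists x, M x /\ hnorm (z - x) ^+ 2 < d + h n ^+ 2.
  move=> n; have [_ [x Mx ->] lt] := inf_adherent (exprn_gt0 2 (h0 n)) Einf.
  by exists x.
clearbody d.
have cau N m n : (N <= m)%N -> (N <= n)%N -> hnorm (u m - u n) <= 2 * h N.
  move=> Nm Nn; rewrite -ler_sqr ?nnegrE ?mulr_ge0 ?hnorm_ge0 ?(ltW (h0 _)) //.
  have hm : h m ^+ 2 <= h N ^+ 2 by rewrite ler_sqr ?nnegrE ?(ltW (h0 _)) //; apply: inv_mono.
  have hn : h n ^+ 2 <= h N ^+ 2 by rewrite ler_sqr ?nnegrE ?(ltW (h0 _)) //; apply: inv_mono.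
  have [Mm lm] := uP m; have [Mn ln] := uP n.
  have half : M ((2^-1)%:C%C *: (u m + u n)).
    rewrite -[X in M X]addr0; apply: (Mlin) => //.
    by rewrite -[u m]scale1r; apply: (Mlin).
  have := dle _ half.
  have -> : z - (2^-1)%:C%C *: (u m + u n) = (2^-1)%:C%C *: ((z - u n) + (z - u m)).
    rewrite [in RHS]addrACA -opprD scalerBr [u n + u m]addrC; congr (_ - _).
    rewrite -mulr2n -scaler_nat scalerA -[LHS]scale1r; congr (_ *: _).
    have -> : (2 : R[i]) = (2 : R)%:C%C by rewrite [RHS](rmorph_nat (real_complex R)).
    by rewrite -rmorphM mulVf ?pnatr_eq0.
  rewrite hnormZr ger0_norm ?invr_ge0 ?ler0n // => dl.
  have := parallelogram (z - u n) (z - u m).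
  have -> : z - u n - (z - u m) = u m - u n by rewrite opprB addrC addrA subrK.
  move: (hnorm (z - u n + _)) (hnorm (u m - u n)) (hnorm (z - u n)) (hnorm (z - u m)) (h m)
    (h n) (h N) hm hn lm ln dl.
  move=> A B C D Hm Hn HN hm hn lm ln dl E4.
  have -> : (2 * HN) ^+ 2 = 4 * HN ^+ 2 by ring.
  have : d * 4 <= A ^+ 2.
    have -> : A ^+ 2 = (2^-1 * A) ^+ 2 * 4 by field.
    by rewrite ler_pM2r.
  move: (A ^+ 2) (B ^+ 2) (C ^+ 2) (D ^+ 2) (Hm ^+ 2) (Hn ^+ 2) (HN ^+ 2) E4 hm hn lm ln.
  move=> *; lra.
have [p pP] : exists l : H, forall e : R, 0 < e -> exists N : nat, forall n : nat, (N <= n)%N ->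
     hnorm (u n - l) < e.
  apply: hcauchy => e e0; have [N hN] := inv_small (divr_gt0 e0 (ltr0Sn R 1)).
  exists N => m n Nm Nn; apply: le_lt_trans (cau _ _ _ Nm Nn) _.
  by rewrite mulrC -ltr_pdivlMr.
have ort n x : M x -> `|hip (z - u n) x| <= (h n * hnorm x)%:C%C.
  move=> Mx; have [->|/eqP x0] := pselect (x = 0).
    by rewrite hip0r normr0 hnorm0 mulr0.
  have n0 : 0 < hnorm x.
    rewrite lt_neqAle hnorm_ge0 andbT eq_sym.
    by apply/eqP => /hnorm_eq0 /eqP; apply/negP.
  rewrite -ler_sqr ?nnegrE //; last by rewrite ler0c mulr_ge0 ?hnorm_ge0 // ltW.
  set q := hip x x; have q0 : 0 < q by rewrite /q hip_hnorm ltcR exprn_gt0.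
  have qr : q^* = q by apply/CrealP; rewrite gtr0_real.
  have [Mu lu] := uP n.
  have [w Ew] : exists w, w = z - u n by exists (z - u n).
  rewrite -Ew in lu *; set c := hip w x.
  (* Projecting the error [w] off [x] lowers its square by |c|^2 / q and cannot go below [d]; thus
     |c|^2 / q is at most the slack [h n ^+ 2]. *)
  have := dle _ (Mlin (c / q) _ _ Mx Mu).
  have -> : z - ((c / q) *: x + u n) = w - (c / q) *: x by rewrite Ew opprD addrCA addrC.
  rewrite -lecR -hip_hnorm => l1.
  have l2 : hip w w <= d%:C%C + (h n ^+ 2)%:C%C by rewrite hip_hnorm -rmorphD lecR ltW.
  move: l1; rewrite !hipBl !hipBr !hipZl !hipZr -/q -/c (hip_conj w x) -/c rmorphM fmorphV /= qr.
  have -> : hip w w - c^* / q * c - (c / q * c^* - c / q * (c^* / q * q)) =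
    hip w w - c * c^* / q by field; rewrite gt_eqF.
  rewrite -normCK lerBrDr => l1; have := le_trans l1 l2.
  rewrite lerD2l ler_pdivrMr // => l3.
  by rewrite (le_trans l3) // [X in _ <= X ^+ 2]rmorphM exprMn hnorm_hip -rmorphXn.
have zp : z = p.
  apply/eqP; rewrite -subr_eq0; apply/eqP; apply: Mtot => x Mx.
  suff E0 : hip (z - p) x = 0 by rewrite hip_conj E0 conjC0.
  apply: (@norm_small R _ (2 * hnorm x)) => e e0.
  have [N1 P1] := pP e e0; have [N2 P2] := inv_small e0.
  set n := maxn N1 N2.
  have -> : z - p = (z - u n) + (u n - p) by rewrite addrA subrK.
  rewrite hipDl (le_trans (ler_normD _ _)) //.
  rewrite (le_trans (lerD (ort n x Mx) (hip_CS _ _))) // -rmorphD lecR.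
  have -> : 2 * hnorm x * e = e * hnorm x + e * hnorm x by ring.
  apply: lerD; apply: ler_wpM2r; rewrite ?hnorm_ge0 //.
    apply: le_trans (ltW P2); apply: inv_mono; exact: leq_maxr.
  by apply/ltW/P1; apply: leq_maxl.
move=> e e0; have [N P] := pP e e0; exists (u N); first by have [] := uP N.
by rewrite zp hnormBC; apply: P.
Qed.

(** Graph of the conjugate-linear extension of [G] to its span. As a relation it tolerates several
    representations of one vector; isometry settles single-valuedness afterwards. *)
Inductive conj_hull (G : H -> H -> Prop) : H -> H -> Prop :=
| conj_hull0 : conj_hull G 0 0
| conj_hullS a x y x' y' : G x y -> conj_hull G x' y' ->
    conj_hull G (a *: x + x') (a^* *: y + y').

Lemma conj_hull_lin G a x y x' y' :
  conj_hull G x y -> conj_hull G x' y' -> conj_hull G (a *: x + x') (a^* *: y + y').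
Proof.
move=> h h'; elim: h => [|b u v u' v' g _ IH]; first by rewrite !scaler0 !add0r.
rewrite !scalerDr !scalerA -!addrA -rmorphM; exact: conj_hullS.
Qed.

Lemma hip_approx z w u v :
  (forall e : R, 0 < e -> exists x y,
     [/\ hnorm (z - x) < e, hnorm (w - y) < e & hip y u = hip v x]) ->
  hip w u = hip v z.
Proof.
move=> h; apply/eqP; rewrite -subr_eq0; apply/eqP.
apply: (@norm_small R _ (hnorm u + hnorm v)) => e /h[x [y [hx hy E]]].
have -> : hip w u - hip v z = hip (w - y) u - hip v (z - x).
  by rewrite hipBl hipBr E; ring.
rewrite (le_trans (ler_normB _ _)) // (le_trans (lerD (hip_CS _ _) (hip_CS _ _))) //.
rewrite -rmorphD lecR mulrDl mulrC.
by apply: lerD; apply: ler_wpM2l; rewrite ?hnorm_ge0 // ltW.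
Qed.

(** The first condition is antiunitarity, which makes the extension isometric and hence continuous.
    The second is symmetry, which survives limits and gives <CCz, v> = <Cv, Cz> = <z, v>; so [G]
    need not be closed under swapping its components. *)
Lemma conjugation_extension (G : H -> H -> Prop) :
  (forall x y x' y', G x y -> G x' y' -> hip y y' = hip x' x) ->
  (forall x y x' y', G x y -> G x' y' -> hip y x' = hip y' x) ->
  total (fun x => exists y, G x y) ->
  exists C : H -> H,
    [/\ is_conjugation C, forall x y, G x y -> C x = y,
      forall x y, hip (C x) (C y) = hip y x & forall x y, hip (C x) y = hip (C y) x].
Proof.
move=> G1 G2 Gtot.
have h1 x y x' y' : conj_hull G x y -> conj_hull G x' y' -> hip y y' = hip x' x.
  move=> h h'; elim: h => [|a u v u' v' g _ IH]; first by rewrite hip0l hip0r.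
  rewrite hipDl hipZl hipDr hipZr IH; congr (_ * _ + _).
  elim: h' => [|b s t s' t' g' _ IH']; first by rewrite hip0l hip0r.
  by rewrite hipDl hipZl hipDr hipZr IH' (G1 _ _ _ _ g g') conjCK.
have h2 x y x' y' : conj_hull G x y -> conj_hull G x' y' -> hip y x' = hip y' x.
  move=> h h'; elim: h => [|a u v u' v' g _ IH]; first by rewrite hip0l hip0r.
  rewrite hipDl hipZl hipDr hipZr IH; congr (_ * _ + _).
  elim: h' => [|b s t s' t' g' _ IH']; first by rewrite hip0l hip0r.
  by rewrite hipDl hipZl hipDr hipZr IH' (G2 _ _ _ _ g g').
have GM x y : G x y -> conj_hull G x y.
  move=> g; rewrite -[x]addr0 -[y]addr0 -[x in X in conj_hull _ X]scale1r.
  rewrite -[y]scale1r -{2}[1]conjC1; apply: conj_hullS => //; exact: conj_hull0.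
have dense : forall z (e : R), 0 < e -> exists2 x, (exists y, conj_hull G x y) & hnorm (z - x) < e.
  apply: span_dense; first by exists 0; apply: conj_hull0.
    move=> a x x' [y g] [y' g']; exists (a^* *: y + y'); exact: conj_hull_lin.
  by move=> z zP; apply: Gtot => x [y g]; apply: zP; exists y; apply: GM.
(* If first components of hull pairs converge to [z], the second ones are Cauchy because the hull is
   isometric; their limit is the value at [z]. *)
have /choice[C CP] : forall z, exists w, forall e : R, 0 < e ->
    exists x y, [/\ conj_hull G x y, hnorm (z - x) < e & hnorm (w - y) < e].
  move=> z.
  have /choice[f fP] : forall n : nat, exists xy : H * H,
      conj_hull G xy.1 xy.2 /\ hnorm (z - xy.1) < n.+1%:R^-1.
    move=> n; have [|x [y g] l] := dense z n.+1%:R^-1; first by rewrite invr_gt0 ltr0Sn.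
    by exists (x, y).
  have [w wP] : exists l : H, forall e : R, 0 < e -> exists N : nat,
      forall n : nat, (N <= n)%N -> hnorm ((f n).2 - l) < e.
    apply: hcauchy => e e0; have [N hN] := inv_small (divr_gt0 e0 (ltr0Sn R 1)).
    exists N => m n Nm Nn; have [gm lm] := fP m; have [gn ln] := fP n.
    have iso u v : conj_hull G u v -> hnorm v = hnorm u.
      by move=> g; apply: hnorm_eq; apply: h1.
    have /iso -> : conj_hull G ((f m).1 - (f n).1) ((f m).2 - (f n).2).
      by have := conj_hull_lin (-1) gn gm; rewrite rmorphN1 !scaleN1r ![- _ + _]addrC.
    rewrite (le_lt_trans (hnorm_triB z _ _)) // [e]splitr.
    have bd k : (N <= k)%N -> hnorm (z - (f k).1) < e / 2.
      move=> Nk; have [_ l] := fP k; rewrite (lt_trans l) // (le_lt_trans _ hN) //.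
      exact: inv_mono.
    by apply: ltrD; [rewrite hnormBC|]; apply: bd.
  exists w => e e0; have [N1 P1] := wP e e0; have [N2 P2] := inv_small e0.
  set n := maxn N1 N2; have [g l] := fP n; exists (f n).1, (f n).2; split=> //.
    rewrite (lt_trans l) // (le_lt_trans _ P2) // inv_mono //; exact: leq_maxr.
  by rewrite hnormBC; apply: P1; apply: leq_maxl.
have C1 z x y : conj_hull G x y -> hip (C z) y = hip x z.
  move=> g; apply: hip_approx => e e0; have [x' [y' [g' l l']]] := CP z e e0.
  by exists x', y'; split=> //; apply: h1.
have C2 z x y : conj_hull G x y -> hip (C z) x = hip y z.
  move=> g; apply: hip_approx => e e0; have [x' [y' [g' l l']]] := CP z e e0.
  by exists x', y'; split=> //; apply: h2.
have CC z z' : hip (C z) (C z') = hip z' z.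
  apply: hip_approx => e e0; have [x' [y' [g' l l']]] := CP z e e0.
  exists x', y'; split=> //; by rewrite hip_conj (C1 _ _ _ g') -hip_conj.
have Cs z z' : hip (C z) z' = hip (C z') z.
  apply: hip_approx => e e0; have [x' [y' [g' l l']]] := CP z e e0.
  by exists x', y'; split=> //; rewrite (C2 _ _ _ g').
have CK z : C (C z) = z by apply: hip_inj => v; rewrite Cs CC.
exists C; split=> //; last first.
  move=> x y g; apply: hip_inj => v; rewrite -(CK v) CC.
  by rewrite hip_conj [RHS]hip_conj (C1 _ _ _ (GM _ _ g)).
split; [|split=> // z; exact: hnorm_eq].
move=> a x y; apply: hip_inj => v; rewrite -(CK v) CC.
by rewrite hipDr hipZr hipDl hipZl !CC.
Qed.

End Extension.

(** * Cauchy's estimate by averaging over roots of unity *)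

Lemma exists_prim_root (R : realType) (n : nat) :
  (0 < n)%N -> exists w : R[i], n.-primitive_root w.
Proof.
move=> n0; have [rs Drs] := closed_field_poly_normal ('X^n - 1 : {poly R[i]}).
rewrite (monicP (monicXnsubC 1 n0)) scale1r in Drs.
have /hasP[w _ wP] : has n.-primitive_root rs; last by exists w.
apply: has_prim_root => //.
- by apply/allP=> w; rewrite -root_prod_XsubC -Drs.
- by rewrite -separable_prod_XsubC -Drs separable_Xn_sub_1 // pnatr_eq0 -lt0n.
- by rewrite -ltnS -[(size rs).+1](size_prod_XsubC rs id) -Drs size_XnsubC.
Qed.

(** Cauchy's estimate for the linear coefficient; a finite average over a circle replaces the
    contour integral and is exact for a polynomial of small degree. *)
Lemma poly_coef1_bound (R : realType) (p : {poly R[i]}) (r B : R) : 0 < r ->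
  (forall l : R[i], `|l| = r%:C%C -> `|p.[l]| <= B%:C%C) ->
  r%:C%C * `|p`_1| <= B%:C%C.
Proof.
(* Since [n] exceeds [size p], the only index below [size p] congruent to 1 modulo [n] is 1 itself.
   The exponent [n.-1] below acts as -1. *)
move=> r0 pB; set n := (size p).+2.
have n0 : (0 < n)%N by [].
have [w wP] := @exists_prim_root R n n0.
have wn : `|w| = 1.
  apply/eqP; rewrite -(@pexpr_eq1 _ _ n) ?normr_ge0 // -normrX.
  by rewrite prim_expr_order ?normr1.
have sumw i : (i < size p)%N ->
    \sum_(j < n) (w ^+ (n.-1 + i)) ^+ j = if i == 1%N then n%:R else 0.
  move=> ip; case: eqP => [->|i1].
    rewrite addn1 prednK // prim_expr_order //.
    by under eq_bigr => j _ do rewrite expr1n; rewrite sumr_const card_ord.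
  set z := w ^+ _.
  have z1 : z - 1 != 0.
    rewrite subr_eq0 /z -(prim_order_dvd wP); apply/negP => /dvdnP[k Ek].
    have : (k < 2)%N.
      rewrite -(ltn_pmul2r n0) -Ek mul2n -addnn -addSn prednK // leq_add2l.
      by rewrite (leq_trans (ltnW ip)) // /n -addn2 leq_addr.
    case: k Ek => [|[|//]]; first by rewrite /n mul0n.
    by move=> Ek _; apply: i1; apply: (@addnI n.-1); rewrite Ek mul1n addn1 prednK.
  apply: (mulfI z1); rewrite mulr0 -subrX1.
  have -> : z ^+ n = 1 by rewrite /z exprAC (prim_expr_order wP) expr1n.
  by rewrite subrr.
have avg : \sum_(j < n) w ^+ (n.-1 * j) * p.[r%:C%C * w ^+ j] = n%:R * (r%:C%C * p`_1).
  under eq_bigr => j _ do rewrite horner_coef mulr_sumr.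
  rewrite exchange_big /=.
  have step (i : 'I_(size p)) : \sum_(j < n) w ^+ (n.-1 * j) *
      (p`_i * (r%:C%C * w ^+ j) ^+ i) = (if i == 1%N :> nat then n%:R else 0) * (p`_i * r%:C%C ^+ i).
    rewrite -sumw // mulr_suml; apply: eq_bigr => j _.
    by rewrite exprMn -!exprM mulnDl exprD [(i * j)%N]mulnC; ring.
  under eq_bigr => i _ do rewrite step.
  have [sp|sp] := ltnP 1 (size p).
    rewrite (bigD1 (Ordinal sp)) //= big1 ?addr0 => [|i ip]; first by rewrite expr1; ring.
    by rewrite -val_eqE /= in ip; rewrite (negbTE ip) mul0r.
  rewrite nth_default // !mulr0 big1 // => i _.
  by case: eqP => [i1|]; [move: (ltn_ord i); rewrite i1 ltnNge sp|rewrite mul0r].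
have : `|n%:R * (r%:C%C * p`_1)| <= n%:R * B%:C%C.
  rewrite -avg (le_trans (ler_norm_sum _ _ _)) //.
  have -> : n%:R * B%:C%C = \sum_(j < n) B%:C%C by rewrite sumr_const card_ord mulr_natl.
  apply: ler_sum => j _.
  rewrite normrM normrX wn expr1n mul1r; apply: pB.
  by rewrite normrM normrX wn expr1n mulr1 ger0_norm // ler0c ltW.
rewrite normrM normr_nat ler_pM2l ?ltr0n // normrM [`|r%:C%C|]ger0_norm //.
by rewrite ler0c ltW.
Qed.

(** * Bounded operators with an adjoint, and Fuglede's theorem *)

Record bop (R : realType) (H : hilbert R) := Bop {
  ap :> H -> H;
  ad : H -> H;
  ap_adj : is_adjoint ap ad;
  ap_bnd : exists M : R, forall x, hnorm (ap x) <= M * hnorm x }.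

Section Bop.
Context {R : realType} {H : hilbert R}.
Implicit Types (A B N : bop H) (a l : R[i]) (x y z : H).

Lemma hip_ad A x y : hip (A x) y = hip x (ad A y).
Proof. exact: ap_adj. Qed.

Lemma hip_adl A x y : hip (ad A x) y = hip x (A y).
Proof. by rewrite hip_conj -hip_ad -hip_conj. Qed.

Lemma apD A x y : A (x + y) = A x + A y.
Proof. by apply: hip_inj => z; rewrite hipDl !hip_ad hipDl. Qed.

Lemma apZ A a x : A (a *: x) = a *: A x.
Proof. by apply: hip_inj => z; rewrite hipZl !hip_ad hipZl. Qed.

Lemma ap0 A : A 0 = 0.
Proof. by have := apZ A 0 0; rewrite !scale0r. Qed.

Lemma apN A x : A (- x) = - A x.
Proof. by rewrite -scaleN1r apZ scaleN1r. Qed.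

Lemma apB A x y : A (x - y) = A x - A y.
Proof. by rewrite apD apN. Qed.

Lemma ap_pos_bnd A : exists2 M : R, 0 < M & forall x, hnorm (A x) <= M * hnorm x.
Proof.
have [M MP] := ap_bnd A; exists (Num.max 1 M); first by rewrite lt_max ltr01.
by move=> x; rewrite (le_trans (MP x)) // ler_wpM2r ?hnorm_ge0 // le_max lexx orbT.
Qed.

Lemma adjoint_bnd A (M : R) : 0 <= M -> (forall x, hnorm (A x) <= M * hnorm x) ->
  forall x, hnorm (ad A x) <= M * hnorm x.
Proof.
move=> M0 MP x; have [E|/eqP n0] := pselect (hnorm (ad A x) = 0).
  by rewrite E mulr_ge0 ?hnorm_ge0.
have np : 0 < hnorm (ad A x) by rewrite lt_neqAle hnorm_ge0 eq_sym n0.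
rewrite -(ler_pM2r np) -expr2 -lecR -hip_hnorm hip_adl.
have := hip_CS x (A (ad A x)); rewrite -hip_adl hip_hnorm ger0_norm ?ler0c ?exprn_ge0 ?hnorm_ge0 //.
move=> h; apply: (le_trans h); rewrite lecR [M * _]mulrC -mulrA.
by apply: ler_wpM2l; rewrite ?hnorm_ge0.
Qed.

Lemma star_subproof A : exists M : R, forall x, hnorm (ad A x) <= M * hnorm x.
Proof. by have [M M0 MP] := ap_pos_bnd A; exists M; apply: adjoint_bnd; rewrite // ltW. Qed.

Definition star A : bop H := Bop (hip_adl A) (star_subproof A).

(** The adjoint is stored as data, but it is determined by the operator, so extensionality holds for
    the record. *)
Lemma bop_eq A B : (forall x, A x = B x) -> A = B.
Proof.
case: A B => [f f' fa fb] [g g' ga gb] /= E.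
have Ef : f = g by apply/funext.
have Ef' : f' = g'.
  apply/funext => x; apply: hip_inj => y.
  by rewrite hip_conj -fa E ga -hip_conj.
by subst; congr Bop; apply: Prop_irrelevance.
Qed.

(* Rosenblum's argument without exponentials: since |x + l S x| = |x + l* N x| for S = N*, the map
   Q |-> Q + l (S Q - Q S) multiplies the bound of Q by at most 1 + O(|l|^2), whereas
   its iterates have first-order term k l (S Q - Q S). *)
Section Fuglede.
Variable N : bop H.
Hypothesis normN : forall x, N (ad N x) = ad N (N x).
Let S := star N.
Let delta (Q : H -> H) x := S (Q x) - Q (S x).
Let D l (Q : H -> H) x := Q x + l *: delta Q x.
Let lin (Q : H -> H) := forall a x y, Q (a *: x + y) = a *: Q x + Q y.

Let lin_delta Q : lin Q -> lin (delta Q).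
Proof.
move=> Ql a x y; rewrite /delta !(apD, apZ, Ql) scalerBr opprD !addrA.
by congr (_ - _); rewrite -!addrA; congr (_ + _); rewrite addrC.
Qed.

Let normS x l : hnorm (x + l *: S x) = hnorm (x + l^* *: N x).
Proof.
apply: hnorm_eq; rewrite !hipDl !hipDr !hipZl !hipZr conjCK.
have -> : hip (S x) (S x) = hip (N x) (N x) by rewrite hip_adl hip_ad normN.
have -> : hip (S x) x = hip x (N x) by exact: hip_adl.
have -> : hip x (S x) = hip (N x) x by rewrite hip_ad.
by ring.
Qed.

(** One has D l Q = (1 + l S) Q (1 - l S) + l^2 S Q S. In the first term [normS] replaces l S by l*
    N, which passes through Q, and a second use of [normS] returns to (1 + l S)(1 - l S) = 1 - l^2
    S^2; no term of first order in l is left. *)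
Let D_bound (Q : H -> H) (M s r : R) l : lin Q -> (forall x, Q (N x) = N (Q x)) ->
  0 <= M -> 0 <= s -> `|l| = r%:C%C -> (forall x, hnorm (S x) <= s * hnorm x) ->
  (forall x, hnorm (Q x) <= M * hnorm x) ->
  forall x, hnorm (D l Q x) <= (1 + 2 * (s * r) ^+ 2) * M * hnorm x.
Proof.
move=> Ql QN M0 s0 lr Ss Qm x.
have hZ y c t : `|c| = t%:C%C -> hnorm (c *: y) = t * hnorm y.
  by move=> E; apply: complexI; rewrite hnormZ E rmorphM.
have l2 : `|l ^+ 2| = (r ^+ 2)%:C%C by rewrite normrX lr -rmorphXn.
have Qadd y z : Q (y + z) = Q y + Q z by have := Ql 1 y z; rewrite !scale1r.
have Q0 : Q 0 = 0 by apply: (addrI (Q 0)); rewrite -Qadd !addr0.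
have QZ a y : Q (a *: y) = a *: Q y by have := Ql a y 0; rewrite Q0 !addr0.
pose w := x - l *: S x.
have -> : D l Q x = (Q w + l *: S (Q w)) + l ^+ 2 *: S (Q (S x)).
  have -> : Q w = Q x - l *: Q (S x) by rewrite /w Qadd -scaleN1r !QZ scaleN1r.
  rewrite /D /delta apB apZ !scalerBr scalerA expr2 -!addrA; congr (_ + _).
  by rewrite addNr addr0 addrC.
have w1 : hnorm (w + l *: S w) <= (1 + (s * r) ^+ 2) * hnorm x.
  have -> : w + l *: S w = x - l ^+ 2 *: S (S x).
    by rewrite /w apB apZ scalerBr scalerA expr2 addrA subrK.
  rewrite (le_trans (hnormB _ _)) // mulrDl mul1r lerD2l (hZ _ _ _ l2).
  have -> : (s * r) ^+ 2 * hnorm x = r ^+ 2 * (s * (s * hnorm x)) by ring.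
  rewrite ler_wpM2l ?exprn_ge0 //; first by rewrite -ler0c -lr.
  by rewrite (le_trans (Ss _)) // ler_wpM2l.
have b1 : hnorm (Q w + l *: S (Q w)) <= M * ((1 + (s * r) ^+ 2) * hnorm x).
  rewrite normS -QN -QZ -Qadd (le_trans (Qm _)) // ler_wpM2l //.
  by rewrite -normS.
have b2 : hnorm (l ^+ 2 *: S (Q (S x))) <= r ^+ 2 * (s * (M * (s * hnorm x))).
  rewrite (hZ _ _ _ l2) ler_wpM2l ?exprn_ge0 //; first by rewrite -ler0c -lr.
  by rewrite (le_trans (Ss _)) // ler_wpM2l // (le_trans (Qm _)) // ler_wpM2l.
rewrite (le_trans (hnormD _ _)) // (le_trans (lerD b1 b2)) //.
by rewrite le_eqVlt; apply/orP; left; apply/eqP; ring.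
Qed.

Let iter_lin k l Q Q' c x :
  iter k (D l) (fun x => Q x + c *: Q' x) x = iter k (D l) Q x + c *: iter k (D l) Q' x.
Proof.
elim: k x => [//|k IH] x /=; rewrite [LHS]/D /delta !IH !apD !apZ.
by apply: hip_inj => z; rewrite /D /delta !(hipDl, hipNl, hipZl); ring.
Qed.

Let iter_poly k Q x y : exists p : {poly R[i]},
  [/\ forall l, p.[l] = hip (iter k (D l) Q x) y, p`_0 = hip (Q x) y
    & p`_1 = k%:R * hip (delta Q x) y].
Proof.
elim: k Q => [|k IH] Q.
  exists (hip (Q x) y)%:P; split; first by move=> l; rewrite hornerC.
    by rewrite coefC.
  by rewrite coefC mul0r.
have [p [p1 p2 p3]] := IH Q; have [q [q1 q2 q3]] := IH (delta Q).
exists (p + q * 'X); split; last 2 first.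
- by rewrite coefD coefMX addr0.
- by rewrite coefD coefMX /= p3 q2 -natr1 mulrDl mul1r.
move=> l; rewrite iterSr /D iter_lin hipDl hipZl -p1 -q1.
by rewrite !hornerE mulrC.
Qed.

Theorem fuglede (Q : bop H) :
  (forall x, Q (N x) = N (Q x)) -> forall x, Q (S x) = S (Q x).
Proof.
move=> QN x; apply/esym/eqP; rewrite -subr_eq0; apply/eqP; apply: hip_eq0 => y.
have [s sp Ss] := ap_pos_bnd S; have [M Mp Qm] := ap_pos_bnd Q.
have Dlin l P : lin P -> lin (D l P).
  move=> Pl a u v; rewrite /D (lin_delta Pl) Pl.
  by apply: hip_inj => z; rewrite !(hipDl, hipNl, hipZl); ring.
have Dcomm l P : (forall x, P (N x) = N (P x)) -> forall x, D l P (N x) = N (D l P x).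
  move=> PN u; rewrite /D /delta !(apD, apZ, apN) -!PN; congr (_ + _ *: (_ - _)).
    by rewrite PN; apply/esym/normN.
  by rewrite (_ : S (N u) = N (S u)) //; apply/esym/normN.
have key n : (0 < n)%N -> (n%:R : R)%:C%C * `|hip (delta Q x) y| <=
    (4 * s * M * hnorm x * hnorm y)%:C%C.
  move=> n0; have n0' : 0 < n%:R :> R by rewrite ltr0n.
  (* With this radius each application of [D l] costs a factor 1 + t, t = 1 / (2 n^2), so n^2
     iterations stay within 2 M. The linear coefficient carries r n^2 = n / (2 s), which is
     unbounded in n. *)
  pose r := (2 * s * n%:R)^-1.
  have r0 : 0 < r by rewrite invr_gt0 !mulr_gt0.
  pose t := 2 * (s * r) ^+ 2.
  have Et : t = (2 * n%:R ^+ 2)^-1 by rewrite /t /r; field; rewrite ?gt_eqF.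
  have it k l : `|l| = r%:C%C -> [/\ lin (iter k (D l) Q),
      forall x, iter k (D l) Q (N x) = N (iter k (D l) Q x) &
      forall x, hnorm (iter k (D l) Q x) <= (1 + t) ^+ k * M * hnorm x].
    move=> lr; elim: k => [|k [I1 I2 I3]] /=.
      split=> //; last by move=> u; rewrite mul1r.
      by move=> a u v; rewrite apD apZ.
    split; [exact: Dlin|exact: Dcomm|move=> u].
    rewrite exprS -mulrA -mulrA [_ * (M * _)]mulrA.
    have := D_bound I1 I2 _ (ltW sp) lr Ss I3 u; rewrite -!mulrA; apply.
    rewrite mulr_ge0 ?(ltW Mp) // exprn_ge0 // addr_ge0 // mulr_ge0 ?exprn_ge0 ?mulr_ge0 ?(ltW sp) ?(ltW r0) //.
  have [p [p1 _ p3]] := iter_poly (n ^ 2) Q x y.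
  (* Bernoulli's inequality gives (1 - t)^(n^2) >= 1/2, and (1 + t)(1 - t) <= 1 carries this over to
     1 + t. *)
  have tk : (1 + t) ^+ (n ^ 2) <= 2.
    have t0 : 0 <= t by rewrite Et invr_ge0 mulr_ge0 ?exprn_ge0 // ltW.
    have t1 : t <= 1.
      rewrite Et invf_le1 ?mulr_gt0 ?exprn_gt0 //.
      by rewrite -natrX -natrM ler1n muln_gt0 expn_gt0 n0.
    have b k : 1 - k%:R * t <= (1 - t) ^+ k.
      elim: k => [|k IH]; first by rewrite mul0r subr0.
      have : (1 - t) * (1 - k%:R * t) <= (1 - t) ^+ k.+1.
        by rewrite exprS ler_wpM2l // subr_ge0.
      apply: le_trans; rewrite -natr1 -subr_ge0.
      have -> : (1 - t) * (1 - k%:R * t) - (1 - (k%:R + 1) * t) = k%:R * t ^+ 2 by ring.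
      by rewrite mulr_ge0 ?exprn_ge0.
    have half : 2^-1 <= (1 - t) ^+ (n ^ 2).
      apply: le_trans (b _); rewrite Et natrX.
      by rewrite le_eqVlt; apply/orP; left; apply/eqP; field; rewrite gt_eqF.
    have : (1 + t) ^+ (n ^ 2) * (1 - t) ^+ (n ^ 2) <= 1.
      have tt : (1 + t) * (1 - t) <= 1.
        have -> : (1 + t) * (1 - t) = 1 - t ^+ 2 by ring.
        by rewrite gerBl exprn_ge0.
      rewrite -exprMn exprn_ile1 //; apply: mulr_ge0; last by rewrite subr_ge0.
      by rewrite addr_ge0.
    have P0 : 0 <= (1 + t) ^+ (n ^ 2) by rewrite exprn_ge0 // addr_ge0.
    move=> h; have := le_trans (ler_wpM2l P0 half) h.
    by rewrite ler_pdivrMr // mul1r.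
  have pB l : `|l| = r%:C%C -> `|p.[l]| <= (2 * M * hnorm x * hnorm y)%:C%C.
    move=> /(it (n ^ 2)%N)[_ _ I]; rewrite p1 (le_trans (hip_CS _ _)) // lecR.
    apply: ler_wpM2r; rewrite ?hnorm_ge0 //; apply: le_trans (I x) _.
    by apply: ler_wpM2r; rewrite ?hnorm_ge0 // ler_wpM2r // ltW.
  have := poly_coef1_bound r0 pB.
  rewrite p3 normrM normr_nat mulrA.
  have -> : r%:C%C * (n ^ 2)%:R = ((2 * s)^-1)%:C%C * (n%:R : R)%:C%C.
    rewrite -(rmorph_nat (real_complex R)) -!rmorphM; congr (_%:C%C).
    by rewrite /r natrX; field; rewrite ?gt_eqF.
  rewrite -mulrA => h.
  have s2 : 0 < (2 * s)%:C%C by rewrite ltcR mulr_gt0.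
  have s1 : (2 * s)%:C%C * ((2 * s)^-1)%:C%C = 1.
    by rewrite -rmorphM mulfV // gt_eqF // mulr_gt0.
  have := ler_wpM2l (ltW s2) h; rewrite [X in X <= _]mulrA s1 mul1r.
  move=> h1; apply: (le_trans h1); rewrite -rmorphM lecR.
  by rewrite le_eqVlt; apply/orP; left; apply/eqP; ring.
apply: (@norm_small R _ (4 * s * M * hnorm x * hnorm y)) => e e0.
have [n nP] := inv_small e0; have := key n.+1 isT.
have n0 : 0 < (n.+1%:R : R)%:C%C by rewrite ltcR ltr0Sn.
rewrite mulrC -ler_pdivlMr // -fmorphV -rmorphM => h; apply: (le_trans h).
rewrite lecR ler_wpM2l ?(ltW nP) // !mulr_ge0 ?hnorm_ge0 ?ltW //.
Qed.

End Fuglede.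
End Bop.

Section BopOps.
Context {R : realType} {H : hilbert R}.
Implicit Types (A B : bop H) (a : R[i]).

Lemma bop_add_adj A B : is_adjoint (fun x => A x + B x) (fun x => ad A x + ad B x).
Proof. by move=> x y; rewrite hipDl hipDr !hip_ad. Qed.

Lemma bop_add_bnd A B : exists M : R, forall x, hnorm (A x + B x) <= M * hnorm x.
Proof.
have [M MP] := ap_bnd A; have [N NP] := ap_bnd B; exists (M + N) => x.
by rewrite (le_trans (hnormD _ _)) // mulrDl lerD.
Qed.

Definition bop_add A B : bop H := Bop (@bop_add_adj A B) (bop_add_bnd A B).

Lemma bop_mul_adj A B : is_adjoint (fun x => A (B x)) (fun x => ad B (ad A x)).
Proof. by move=> x y; rewrite !hip_ad. Qed.

Lemma bop_mul_bnd A B : exists M : R, forall x, hnorm (A (B x)) <= M * hnorm x.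
Proof.
have [M M0 MP] := ap_pos_bnd A; have [N NP] := ap_bnd B; exists (M * N) => x.
by rewrite (le_trans (MP _)) // -mulrA ler_wpM2l // ltW.
Qed.

Definition bop_mul A B : bop H := Bop (@bop_mul_adj A B) (bop_mul_bnd A B).

Lemma bop_cst_adj a : @is_adjoint R H (fun x => a *: x) (fun x => a^* *: x).
Proof. by move=> x y; rewrite hipZl hipZr conjCK. Qed.

Lemma bop_cst_bnd a : exists M : R, forall x : H, hnorm (a *: x) <= M * hnorm x.
Proof.
exists (complex.Re `|a|) => x; rewrite -lecR hnormZ.
by have {1}<- := RRe_real (normr_real a); rewrite -rmorphM.
Qed.

Definition bop_cst a : bop H := Bop (@bop_cst_adj a) (bop_cst_bnd a).

End BopOps.

(** * The commutative algebra generated by a commuting family *)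

Record commuting_family (R : realType) (H : hilbert R) := CommutingFamily {
  gens :> bop H -> Prop;
  gens_comm : forall A B x, gens A -> gens B -> A (B x) = B (A x);
  gens_star : forall A, gens A -> gens (star A) }.

Definition commutant (R : realType) (H : hilbert R) (G : bop H -> Prop) (Q : bop H) :=
  forall g x, G g -> Q (g x) = g (Q x).

(** The bicommutant of [G]. Defined by commutation, it is closed under products, adjoints and
    uniform limits without any mention of topology. *)
Record alg (R : realType) (H : hilbert R) (G : commuting_family H) := Alg {
  aop :> bop H;
  aopP : forall Q x, commutant G Q -> aop (Q x) = Q (aop x) }.

Section Alg.
Context {R : realType} {H : hilbert R} {G : commuting_family H}.
Implicit Types (A B : alg G) (x y z : H) (a : R[i]).

Lemma alg_eq A B : (forall x, A x = B x) -> A = B.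
Proof.
case: A B => [A AP] [B BP] /= /bop_eq E; subst.
by rewrite (Prop_irrelevance AP BP).
Qed.

(** The generators commute, hence lie in their own commutant; so [B] commutes with them, lies in the
    commutant as well, and therefore commutes with [A]. *)
Lemma alg_comm A B x : A (B x) = B (A x).
Proof.
apply: (aopP A) => g y Gg; apply: (aopP B) => h z Gh; exact: (gens_comm _ Gg Gh).
Qed.

Lemma gen_aopP g : G g -> forall Q x, commutant G Q -> g (Q x) = Q (g x).
Proof. by move=> Gg Q x QG; rewrite QG. Qed.

Definition alg_gen g (Gg : G g) : alg G := Alg (gen_aopP Gg).

Lemma add_aopP A B Q x : commutant G Q -> bop_add A B (Q x) = Q (bop_add A B x).
Proof. by move=> QG; rewrite /= apD (aopP A x QG) (aopP B x QG). Qed.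

Definition alg_add A B : alg G := Alg (@add_aopP A B).

Lemma mul_aopP A B Q x : commutant G Q -> bop_mul A B (Q x) = Q (bop_mul A B x).
Proof. by move=> QG; rewrite /= (aopP B x QG) (aopP A _ QG). Qed.

Definition alg_mul A B : alg G := Alg (@mul_aopP A B).

Lemma cst_aopP a Q x : commutant G Q -> bop_cst a (Q x) = Q (bop_cst a x).
Proof. by move=> QG; rewrite /= apZ. Qed.

Definition cst a : alg G := Alg (@cst_aopP a).

(** As [G] is closed under adjoints, so is its commutant; the claim is the adjoint of the relation
    between [A] and [star Q]. *)
Lemma star_aopP A Q x : commutant G Q -> star A (Q x) = Q (star A x).
Proof.
move=> QG; apply: hip_inj => y; rewrite hip_adl.
have Q'G : commutant G (star Q).
  move=> g z Gg; apply: hip_inj => w; rewrite hip_adl hip_ad.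
  by have /= <- := QG (star g) w (gens_star Gg); rewrite -hip_adl -hip_ad.
by rewrite hip_ad -[ad Q _]/(star Q (A y)) -(aopP A) // hip_ad hip_adl.
Qed.

Definition starA A : alg G := Alg (@star_aopP A).

HB.instance Definition _ := gen_eqMixin (alg G).
HB.instance Definition _ := gen_choiceMixin (alg G).

Lemma alg_addA : associative alg_add.
Proof. by move=> A B C; apply: alg_eq => x; apply: addrA. Qed.
Lemma alg_addC : commutative alg_add.
Proof. by move=> A B; apply: alg_eq => x; apply: addrC. Qed.
Lemma alg_add0 : left_id (cst 0) alg_add.
Proof. by move=> A; apply: alg_eq => x /=; rewrite scale0r add0r. Qed.
Lemma alg_addN : left_inverse (cst 0) (alg_mul (cst (- 1))) alg_add.
Proof. by move=> A; apply: alg_eq => x /=; rewrite scaleN1r addNr scale0r. Qed.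

HB.instance Definition _ := GRing.isZmodule.Build (alg G) alg_addA alg_addC alg_add0 alg_addN.

Lemma alg_mulA : associative alg_mul.
Proof. by move=> A B C; apply: alg_eq. Qed.
Lemma alg_mulC : commutative alg_mul.
Proof. by move=> A B; apply: alg_eq => x; apply: alg_comm. Qed.
Lemma alg_mul1 : left_id (cst 1) alg_mul.
Proof. by move=> A; apply: alg_eq => x; apply: scale1r. Qed.
Lemma alg_mulDl : left_distributive alg_mul alg_add.
Proof. by move=> A B C; apply: alg_eq. Qed.

(** This structure lets [ring] prove the operator identities below. The ring may be zero, since [H]
    may be the zero space. *)
HB.instance Definition _ := GRing.Zmodule_isComPzRing.Build (alg G)
  alg_mulA alg_mulC alg_mul1 alg_mulDl.

Lemma algDE A B x : (A + B) x = A x + B x.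
Proof. by []. Qed.
Lemma algNE A x : (- A) x = - A x.
Proof. exact: scaleN1r. Qed.
Lemma algBE A B x : (A - B) x = A x - B x.
Proof. by rewrite algDE algNE. Qed.
Lemma algME A B x : (A * B) x = A (B x).
Proof. by []. Qed.
Lemma alg0E x : (0 : alg G) x = 0.
Proof. exact: scale0r. Qed.
Lemma alg1E x : (1 : alg G) x = x.
Proof. exact: scale1r. Qed.
Lemma cstE a x : cst a x = a *: x.
Proof. by []. Qed.

Lemma hip_star A x y : hip (A x) y = hip x (starA A y).
Proof. exact: hip_ad. Qed.

Lemma starAK A : starA (starA A) = A.
Proof. by apply: alg_eq => x; apply: hip_inj => y; rewrite [LHS]hip_adl hip_star. Qed.

Lemma starAE A B : (forall x y, hip (A x) y = hip x (B y)) -> starA A = B.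
Proof.
move=> E; apply: alg_eq => x; apply: hip_inj => y.
by rewrite hip_conj -hip_star E -hip_conj.
Qed.

Lemma starAD A B : starA (A + B) = starA A + starA B.
Proof. by apply: starAE => x y; rewrite !algDE hipDl hipDr !hip_star. Qed.
Lemma starAN A : starA (- A) = - starA A.
Proof. by apply: starAE => x y; rewrite !algNE hipNl hipNr !hip_star. Qed.
Lemma starAM A B : starA (A * B) = starA A * starA B.
Proof. by apply: starAE => x y; rewrite !algME alg_comm !hip_star. Qed.
Lemma starA_cst a : starA (cst a) = cst a^*.
Proof. by apply: starAE => x y; rewrite !cstE hipZl hipZr conjCK. Qed.
Lemma starA0 : starA 0 = 0.
Proof. by rewrite (_ : 0 = cst 0) // starA_cst conjC0. Qed.
Lemma starA1 : starA 1 = 1.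
Proof. by rewrite (_ : 1 = cst 1) // starA_cst conjC1. Qed.
Lemma cstM a b : cst (a * b) = cst a * cst b.
Proof. by apply: alg_eq => x; rewrite algME !cstE scalerA. Qed.
Lemma cstD a b : cst (a + b) = cst a + cst b.
Proof. by apply: alg_eq => x; rewrite algDE !cstE scalerDl. Qed.

Lemma hip_starl A x y : hip (starA A x) y = hip x (A y).
Proof. by rewrite hip_star starAK. Qed.

End Alg.

(** * Square roots of positive elements of the algebra *)

Section SquareRoot.
Context {R : realType} {H : hilbert R} {G : commuting_family H}.
Implicit Types (A B : alg G) (x y z : H).

(** Self-adjoint approximants make the pointwise limit its own adjoint, which supplies the adjoint
    field of the record. *)
Lemma alg_limit (Y : nat -> alg G) :
  (forall e : R, 0 < e -> exists N : nat, forall m n, (N <= m)%N -> (N <= n)%N ->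
     forall x, hnorm ((Y m - Y n) x) <= e * hnorm x) ->
  (forall n, starA (Y n) = Y n) ->
  exists2 L : alg G, starA L = L & forall e : R, 0 < e ->
    exists N : nat, forall n, (N <= n)%N -> forall x, hnorm ((L - Y n) x) <= e * hnorm x.
Proof.
move=> Yc Ys.
have /choice[f fP] : forall x, exists l, forall e : R, 0 < e -> exists N : nat,
    forall n : nat, (N <= n)%N -> hnorm (Y n x - l) < e.
  move=> x; apply: hcauchy => e e0.
  have p0 : 0 < hnorm x + 1 by rewrite ltr_wpDl ?hnorm_ge0.
  have [N NP] := Yc (e / (hnorm x + 1)) (divr_gt0 e0 p0).
  exists N => m n Nm Nn; rewrite -algBE (le_lt_trans (NP _ _ Nm Nn x)) //.
  by rewrite -mulrA gtr_pMr // mulrC ltr_pdivrMr // mul1r ltrDl.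
have fb (e : R) : 0 < e -> exists N : nat, forall n, (N <= n)%N ->
    forall x, hnorm (f x - Y n x) <= e * hnorm x.
  move=> e0; have [N NP] := Yc e e0; exists N => n Nn x; apply/ler_addgt0Pr => d d0.
  have [N' N'P] := fP x d d0; set m := maxn N N'.
  rewrite (le_trans (hnorm_triB (Y m x) _ _)) // addrC lerD //.
    by rewrite -algBE; apply: NP => //; apply: leq_maxl.
  by rewrite hnormBC ltW // N'P // leq_maxr.
have fa : is_adjoint f f.
  move=> x y; apply/eqP; rewrite -subr_eq0; apply/eqP.
  apply: (@norm_small R _ (2 * (hnorm x * hnorm y))) => e e0.
  have [N NP] := fb e e0; have := NP N (leqnn N) => {NP}NP.
  have -> : hip (f x) y - hip x (f y) = hip (f x - Y N x) y - hip x (f y - Y N y).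
    have E : hip (Y N x) y = hip x (Y N y) by rewrite hip_star Ys.
    by rewrite hipBl hipBr E; ring.
  rewrite (le_trans (ler_normB _ _)) // (le_trans (lerD (hip_CS _ _) (hip_CS _ _))) //.
  rewrite -rmorphD lecR.
  have -> : 2 * (hnorm x * hnorm y) * e = e * hnorm x * hnorm y + hnorm x * (e * hnorm y) by ring.
  by apply: lerD; [apply: ler_wpM2r|apply: ler_wpM2l]; rewrite ?hnorm_ge0.
have fM : exists M : R, forall x, hnorm (f x) <= M * hnorm x.
  have [N NP] := fb 1 ltr01; have [M MP] := ap_bnd (Y N); exists (1 + M) => x.
  rewrite -[f x](subrK (Y N x)) (le_trans (hnormD _ _)) // mulrDl lerD //.
  exact: NP.
pose F := Bop fa fM.
have FP Q x : commutant G Q -> F (Q x) = Q (F x).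
  move=> QG; apply/eqP; rewrite -subr_eq0; apply/eqP/hnorm_small => e e0.
  have [M M0 MP] := ap_pos_bnd Q.
  have p0 : 0 < 2 * M * (hnorm x + 1) by rewrite !mulr_gt0 // ltr_wpDl ?hnorm_ge0.
  have [N NP] := fb (e / (2 * M * (hnorm x + 1))) (divr_gt0 e0 p0).
  set d := e / _ in NP; have d0 : 0 < d by rewrite divr_gt0.
  have -> : F (Q x) - Q (F x) = (f (Q x) - Y N (Q x)) - Q (f x - Y N x).
    rewrite apB /= (aopP (Y N) x QG) opprB addrA subrK //.
  apply: (@le_lt_trans _ _ (d * (2 * M * hnorm x))).
    rewrite (le_trans (hnormB _ _)) //.
    have -> : d * (2 * M * hnorm x) = d * (M * hnorm x) + M * (d * hnorm x) by ring.
    apply: lerD; first by rewrite (le_trans (NP _ _ _)) // ler_wpM2l ?MP // ltW.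
    by rewrite (le_trans (MP _)) // ler_wpM2l ?NP // ltW.
  have -> : e = d * (2 * M * (hnorm x + 1)) by rewrite /d divfK // gt_eqF.
  by rewrite ltr_pM2l // ltr_pM2l ?mulr_gt0 // ltrDl.
exists (Alg FP); first exact: starAE.
by move=> e /fb[N NP]; exists N => n Nn x; rewrite algBE; apply: NP.
Qed.

(* the operator iteration of contraction_root in the extremal case X = 1, which majorizes it *)
Fixpoint half_iter (n : nat) : R :=
  if n is m.+1 then (1 + half_iter m ^+ 2) / 2 else 0.

Lemma half_iter_bnd n : 0 <= half_iter n <= 1.
Proof.
elim: n => [|n /andP[h0 h1]] /=; first by rewrite lexx ler01.
have := exprn_ile1 2 h0 h1; have := sqr_ge0 (half_iter n).
by move: (half_iter n ^+ 2) => t *; apply/andP; split; lra.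
Qed.

Lemma half_iter_incr n : half_iter n <= half_iter n.+1.
Proof.
rewrite /= ler_pdivlMr // -subr_ge0.
have -> : 1 + half_iter n ^+ 2 - half_iter n * 2 = (1 - half_iter n) ^+ 2 by ring.
exact: sqr_ge0.
Qed.

Lemma half_iter_cauchy (e : R) : 0 < e -> exists N, forall n, (N <= n)%N ->
  half_iter n - half_iter N <= e.
Proof.
move=> e0; pose E : set R := fun t => exists n, t = half_iter n.
have sE : has_sup E.
  split; first by exists (half_iter 0); exists 0.
  by exists 1 => _ [n ->]; case/andP: (half_iter_bnd n).
have [_ [N ->] lN] := sup_adherent e0 sE; exists N => n Nn.
rewrite lerBlDr -lerBlDl; apply: le_trans (ltW lN); rewrite lerD2r.
by apply: ub_le_sup; [exact: sE.2|exists n].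
Qed.

(* I - sqrt (I - X) for a self-adjoint contraction X. *)
Lemma contraction_root (X : alg G) :
  starA X = X -> (forall x, hnorm (X x) <= hnorm x) ->
  exists2 L : alg G, starA L = L & L + L = X + L * L.
Proof.
move=> Xs Xb.
pose h : alg G := cst (2^-1 : R)%:C%C.
have hh A : h * A + h * A = A.
  have -> : h * A + h * A = (h + h) * A by ring.
  rewrite -cstD -rmorphD /= -[2^-1]mul1r -splitr; exact: mul1r.
(* A fixed point of this iteration satisfies 2 L = X + L^2, that is (1 - L)^2 = 1 - X. *)
pose Y := fix Y n : alg G := if n is m.+1 then h * (X + Y m * Y m) else 0.
have hs : starA h = h by rewrite starA_cst; congr cst; apply/CrealP; rewrite complex_real.
have Ys n : starA (Y n) = Y n.
  by elim: n => [|n IH] /=; rewrite ?starA0 // !(starAM, starAD) IH hs Xs.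
have hb A x : hnorm ((h * A) x) = 2^-1 * hnorm (A x).
  by rewrite algME cstE hnormZr ger0_norm // invr_ge0.
have Yb n x : hnorm (Y n x) <= half_iter n * hnorm x.
  elim: n x => [|n IH] x; first by rewrite alg0E hnorm0 mul0r.
  rewrite [Y _]/(h * (X + Y n * Y n)) hb algDE algME mulrC ler_pdivrMr //=.
  have -> : (1 + half_iter n ^+ 2) / 2 * hnorm x * 2 =
     hnorm x + half_iter n * (half_iter n * hnorm x) by field.
  rewrite (le_trans (hnormD _ _)) // lerD // (le_trans (IH _)) // ler_wpM2l //.
  by case/andP: (half_iter_bnd n).
have Yd n x : hnorm ((Y n.+1 - Y n) x) <= (half_iter n.+1 - half_iter n) * hnorm x.
  elim: n x => [|n IH] x.
    rewrite (_ : Y 1%N - Y 0%N = h * X) /=; last by ring.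
    by rewrite hb expr0n addr0 subr0 mul1r ler_wpM2l ?invr_ge0.
  (* A difference of squares factors because the algebra is commutative; [half_iter] factors
     identically, so its increments bound those of [Y]. *)
  have -> : Y n.+2 - Y n.+1 = h * ((Y n.+1 + Y n) * (Y n.+1 - Y n)).
    have E1 : Y n.+1 = h * (X + Y n * Y n) by [].
    have E2 : Y n.+2 = h * (X + Y n.+1 * Y n.+1) by [].
    by rewrite E2 [Z in _ - Z = _]E1; ring.
  rewrite hb algME.
  have b z : hnorm ((Y n.+1 + Y n) z) <= (half_iter n.+1 + half_iter n) * hnorm z.
    by rewrite algDE (le_trans (hnormD _ _)) // mulrDl lerD.
  have -> : half_iter n.+2 - half_iter n.+1 =
      2^-1 * ((half_iter n.+1 + half_iter n) * (half_iter n.+1 - half_iter n)).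
    by rewrite /=; field.
  rewrite -mulrA ler_wpM2l ?invr_ge0 // (le_trans (b _)) // -mulrA ler_wpM2l //.
  by rewrite addr_ge0 //; [case/andP: (half_iter_bnd n.+1)|case/andP: (half_iter_bnd n)].
have Yd2 N n x : (N <= n)%N -> hnorm ((Y n - Y N) x) <= (half_iter n - half_iter N) * hnorm x.
  move=> /subnK <-; elim: (n - N)%N => [|k IH]; first by rewrite !subrr alg0E hnorm0 mul0r.
  rewrite addSn (_ : Y _ - Y N = (Y (k + N).+1 - Y (k + N)%N) + (Y (k + N)%N - Y N)).
    rewrite algDE (le_trans (hnormD _ _)) // (le_trans (lerD (Yd _ _) IH)) //.
    by rewrite -mulrDl addrA subrK.
  by rewrite addrA subrK.
have Yc (e : R) : 0 < e -> exists N : nat, forall m n, (N <= m)%N -> (N <= n)%N ->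
     forall x, hnorm ((Y m - Y n) x) <= e * hnorm x.
  move=> e0; have [N NP] := half_iter_cauchy (divr_gt0 e0 (ltr0Sn R 1)).
  exists N => m n Nm Nn x; rewrite (_ : Y m - Y n = (Y m - Y N) - (Y n - Y N)); last by ring.
  rewrite algBE (le_trans (hnormB _ _)) // [e]splitr mulrDl.
  by apply: lerD; apply: (le_trans (Yd2 _ _ _ _)) => //; apply: ler_wpM2r; rewrite ?hnorm_ge0 // NP.
have [L Ls LP] := alg_limit Yc Ys; exists L => //.
have Lb x : hnorm (L x) <= hnorm x.
  apply/ler_addgt0Pr => e e0.
  have p0 : 0 < hnorm x + 1 by rewrite ltr_wpDl ?hnorm_ge0.
  have [N NP] := LP (e / (hnorm x + 1)) (divr_gt0 e0 p0).
  have -> : L x = Y N x + (L - Y N) x by rewrite -algDE; congr (aop _ x); ring.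
  rewrite (le_trans (hnormD _ _)) // lerD //.
    by rewrite (le_trans (Yb _ _)) // ler_piMl ?hnorm_ge0 //; case/andP: (half_iter_bnd N).
  by rewrite (le_trans (NP _ _ _)) // -mulrA ger_pMr // mulrC ler_pdivrMr // mul1r lerDl.
apply/eqP; rewrite -subr_eq0; apply/eqP; apply: alg_eq => x; rewrite alg0E.
apply: hnorm_small => e e0.
have p0 : 0 < 4 * (hnorm x + 1) by rewrite mulr_gt0 // ltr_wpDl ?hnorm_ge0.
have [N NP] := LP (e / (4 * (hnorm x + 1))) (divr_gt0 e0 p0).
set d := e / _ in NP; have d0 : 0 < d by rewrite divr_gt0.
have -> : L + L - (X + L * L) = (L - Y N.+1) + (L - Y N.+1) - (L + Y N) * (L - Y N).
  have EX : X = Y N.+1 + Y N.+1 - Y N * Y N.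
    by rewrite [Y N.+1]/(h * (X + Y N * Y N)) hh addrK.
  by rewrite [in LHS]EX; ring.
have b z : hnorm ((L + Y N) z) <= 2 * hnorm z.
  rewrite algDE (le_trans (hnormD _ _)) // mulrDl mul1r lerD //.
  by rewrite (le_trans (Yb _ _)) // ler_piMl ?hnorm_ge0 //; case/andP: (half_iter_bnd N).
apply: (@le_lt_trans _ _ (d * (4 * hnorm x))).
  rewrite algBE algDE (le_trans (hnormB _ _)) //.
  have -> : d * (4 * hnorm x) = (d * hnorm x + d * hnorm x) + 2 * (d * hnorm x) by ring.
  apply: lerD.
    by rewrite (le_trans (hnormD _ _)) // lerD // NP.
  by rewrite algME (le_trans (b _)) // ler_wpM2l // NP.
have -> : e = d * (4 * (hnorm x + 1)) by rewrite /d divfK // gt_eqF.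
by rewrite ltr_pM2l // ltr_pM2l // ltrDl.
Qed.

Lemma alg_sqrt (P Q : alg G) :
  exists2 s : alg G, starA s = s & s * s = starA P * P + starA Q * Q.
Proof.
set D := starA P * P + starA Q * Q.
have [M M0 MP] := ap_pos_bnd P; have [N N0 NP] := ap_pos_bnd Q.
pose k := M ^+ 2 + N ^+ 2.
have k0 : 0 < k by rewrite addr_gt0 ?exprn_gt0.
have Ds : starA D = D by rewrite starAD !starAM !starAK; congr (_ + _); rewrite mulrC.
have Dx x : complex.Re (hip (D x) x) = hnorm (P x) ^+ 2 + hnorm (Q x) ^+ 2.
  rewrite algDE !algME hipDl !hip_starl !hip_hnorm.
  by [].
have Db x : hnorm (D x) ^+ 2 <= k * (hnorm (P x) ^+ 2 + hnorm (Q x) ^+ 2).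
  have b1 : hnorm (D x) <= M * hnorm (P x) + N * hnorm (Q x).
    rewrite algDE !algME (le_trans (hnormD _ _)) //.
    by apply: lerD; apply: adjoint_bnd; rewrite // ltW.
  have : hnorm (D x) ^+ 2 <= (M * hnorm (P x) + N * hnorm (Q x)) ^+ 2.
    by rewrite ler_sqr ?nnegrE ?addr_ge0 ?mulr_ge0 ?hnorm_ge0 // ltW.
  move=> h; apply: (le_trans h); rewrite -subr_ge0 /k.
  set p := hnorm (P x); set q := hnorm (Q x).
  have -> : (M ^+ 2 + N ^+ 2) * (p ^+ 2 + q ^+ 2) - (M * p + N * q) ^+ 2 = (M * q - N * p) ^+ 2.
    by ring.
  exact: sqr_ge0.
(* [Db] says |D x|^2 <= k <D x, x>; expanding |x - D x / k|^2 then shows that [X] is a contraction,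
   and (1 - L)^2 = D / k. *)
pose X : alg G := 1 - cst (k^-1)%:C%C * D.
have ck (r : R) : starA (cst r%:C%C : alg G) = cst r%:C%C.
  by rewrite starA_cst; congr cst; apply/CrealP; rewrite complex_real.
have Xs : starA X = X by rewrite starAD starAN starAM starA1 ck Ds.
have Xb x : hnorm (X x) <= hnorm x.
  rewrite -ler_sqr ?nnegrE ?hnorm_ge0 //.
  have -> : X x = x - (k^-1)%:C%C *: D x by rewrite algBE alg1E.
  have -> : hnorm (x - (k^-1)%:C%C *: D x) ^+ 2 =
      hnorm x ^+ 2 - 2 * (k^-1 * complex.Re (hip (D x) x)) + (k^-1) ^+ 2 * hnorm (D x) ^+ 2.
    rewrite !hnorm_re hipBl !hipBr !hipZl !hipZr (hip_conj (D x) x).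
    case: (hip (D x) x) (hip x x) (hip (D x) (D x)) => [a b] [c d] [f g] /=; ring.
  rewrite Dx; set t := _ + _ ^+ 2.
  have h1 : (k^-1) ^+ 2 * hnorm (D x) ^+ 2 <= k^-1 * t.
    have -> : k^-1 * t = (k^-1) ^+ 2 * (k * t) by field; rewrite gt_eqF.
    by rewrite ler_wpM2l ?exprn_ge0 ?invr_ge0 ?(ltW k0) ?Db.
  have t0 : 0 <= k^-1 * t by rewrite mulr_ge0 ?invr_ge0 ?(ltW k0) // addr_ge0 // sqr_ge0.
  move: (k^-1 * t) (k^-1 ^+ 2 * _) (hnorm x ^+ 2) h1 t0 => *; lra.
have [L Ls LE] := contraction_root Xs Xb.
exists (cst (Num.sqrt k)%:C%C * (1 - L)).
  by rewrite starAM starAD starAN starA1 Ls ck.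
set c : alg G := cst _.
have cc : c * c = cst k%:C%C by rewrite -cstM -rmorphM -expr2 sqr_sqrtr // ltW.
have -> : c * (1 - L) * (c * (1 - L)) = c * c * (1 - (L + L) + L * L) by ring.
rewrite LE cc /X.
have -> : cst k%:C%C * (1 - (1 - cst k^-1%:C%C * D + L * L) + L * L) =
  (cst k%:C%C * cst k^-1%:C%C) * D by ring.
by rewrite -cstM -rmorphM mulfV ?gt_eqF // rmorph1 mul1r.
Qed.

End SquareRoot.

(** * A conjugation adapted to the algebra *)

Lemma conjugation_intertwine (R : realType) (H : hilbert R) (C T S : H -> H) (D : H -> Prop) :
  (forall x y, hip (C x) y = hip (C y) x) -> is_adjoint T S -> total D ->
  (forall x, D x -> C (T x) = S (C x)) -> forall x, C (T x) = S (C x).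
Proof.
(* Symmetry of [C] exchanges [x] and [y] in <C T x, y> - <S C x, y> up to sign, so the relation
   known at [y] in [D] gives it at every [x], with no density or continuity argument. *)
move=> Cs adj Dtot CD x; apply/eqP; rewrite -subr_eq0; apply/eqP; apply: Dtot => y Dy.
suff E : hip (C (T x) - S (C x)) y = 0 by rewrite hip_conj E conjC0.
have adj' z w : hip (S z) w = hip z (T w) by rewrite hip_conj -adj -hip_conj.
by rewrite hipBl Cs -adj' -CD // adj' [X in X - _]Cs subrr.
Qed.

Section AlgConjugation.
Context {R : realType} {H : hilbert R} (G : commuting_family H).
Implicit Types (A B : alg G) (x y z : H).

(* Zorn decomposes H into an orthogonal sum of cyclic subspaces [G e]; there J is A e |-> A* e. *)
Lemma alg_conjugation : exists J : H -> H,
  [/\ is_conjugation J, forall x y, hip (J x) (J y) = hip y x,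
     forall x y, hip (J x) y = hip (J y) x & forall A x, J (A x) = starA A (J x)].
Proof.
(* Since products and adjoints stay in the algebra, this says that the cyclic subspaces of distinct
   vectors of [E] are orthogonal. *)
pose P (E : set H) := forall e e', E e -> E e' -> e <> e' -> forall A, hip (A e) e' = 0.
have [F FP Ftot|E [EP Emax]] := @Zorn_bigcup H P.
  move=> e e' [X FX Xe] [Y FY Ye']; have [XY|YX] := Ftot _ _ FX FY.
    by apply: (FP _ FY) => //; apply: XY.
  by apply: (FP _ FX) => //; apply: YX.
pose D x y := exists e A, [/\ E e, x = A e & y = starA A e].
have Etot : total (fun x => exists y, D x y).
  move=> z zP.
  have zE e A : E e -> hip (A e) z = 0.
    by move=> Ee; apply: zP; exists (starA A e), e, A.
  (* A nonzero [z] orthogonal to all cyclic subspaces could be added to [E]; it is not there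
     already, being orthogonal to itself otherwise. *)
  apply: contrapT => z0; apply: (Emax (fun x => E x \/ x = z)).
    split=> [x|/(_ z (or_intror erefl)) Ez]; first by left.
    by apply/z0/hip_def; rewrite -[X in hip X _](alg1E (G := G)) zE.
  move=> e e' [Ee|->] [Ee'|->] ne A //; [exact: EP|exact: zE|].
  by rewrite hip_star hip_conj zE ?conjC0.
have [||//|J [J1 J2 J3 J4]] := @conjugation_extension R H D.
- move=> x y x' y' [e [A [Ee -> ->]]] [e' [A' [Ee' -> ->]]].
  have -> : hip (starA A e) (starA A' e') = hip ((A' * starA A) e) e' by rewrite -hip_star.
  have -> : hip (A' e') (A e) = hip ((starA A * A') e') e by rewrite algME hip_starl.
  have [<-|/eqP ne] := pselect (e = e'); first by rewrite mulrC.
  have ne' : e' <> e by move=> E'; move: ne; rewrite E' eqxx.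
  by rewrite !EP //; apply/eqP.
- move=> x y x' y' [e [A [Ee -> ->]]] [e' [A' [Ee' -> ->]]].
  have -> : hip (starA A e) (A' e') = hip e ((A * A') e') by rewrite hip_starl.
  have -> : hip (starA A' e') (A e) = hip e' ((A' * A) e) by rewrite hip_starl.
  have [<-|/eqP ne] := pselect (e = e'); first by rewrite mulrC.
  have ne' : e' <> e by move=> E'; move: ne; rewrite E' eqxx.
  by rewrite hip_conj EP // conjC0 [RHS]hip_conj EP ?conjC0 //; apply/eqP.
exists J; split=> // A.
apply: (conjugation_intertwine (S := starA A) J4 _ Etot) => [x y|x [y [e [B [Ee -> _]]]]].
  by rewrite hip_star.
have DJ (B' : alg G) : J (B' e) = starA B' e by apply: J2; exists e, B'.
by rewrite -algME !DJ starAM.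
Qed.

End AlgConjugation.

(** * Two-by-two matrices over the algebra *)

Section TwoByTwo.
Context {R : realType} {K : hilbert R} (G : commuting_family K).
Implicit Types (A B : alg G) (a b x y z : K).

Let ii : alg G := cst 'i%C.

Let ii2 : ii * ii = - 1.
Proof.
rewrite /ii -cstM -expr2 sqr_i; apply: alg_eq => x.
by rewrite cstE scaleN1r algNE alg1E.
Qed.

Let starA_ii : starA ii = - ii.
Proof.
have ci : ('i%C : R[i])^* = - 'i%C by apply/eqP; rewrite eq_complex /= oppr0 !eqxx.
rewrite starA_cst ci; apply: alg_eq => x.
by rewrite cstE algNE cstE scaleNr.
Qed.

Lemma hipM A B x y : hip (A x) (B y) = hip ((starA B * A) x) y.
Proof. by rewrite algME hip_starl. Qed.

Lemma hipDA A B x y : hip (A x) y + hip (B x) y = hip ((A + B) x) y.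
Proof. by rewrite algDE hipDl. Qed.

(* The symmetric matrix S = [p, q; q, p*] satisfies S* S = s^2. *)
Definition scaled_unitary (p q s : alg G) :=
  [/\ starA s = s, starA q = - q & s * s = starA p * p + starA q * q].

(** Here <s^2 a, a> = |p a|^2 + |q a|^2, and [p] is normal, so its adjoint has the same kernel.
    Later this makes different stages orthogonal. *)
Lemma scaled_unitary_ker p q s a : scaled_unitary p q s -> s a = 0 ->
  [/\ p a = 0, q a = 0 & starA p a = 0].
Proof.
move=> [ss qs sE] sa.
have E0 : hip (p a) (p a) + hip (q a) (q a) = 0.
  by rewrite !hipM hipDA -sE algME sa ap0 hip0l.
have [Ep Eq] : hip (p a) (p a) = 0 /\ hip (q a) (q a) = 0.
  have [p0 q0] := (hip_ge0 (p a), hip_ge0 (q a)).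
  by move/eqP: E0; rewrite paddr_eq0 // => /andP[/eqP ? /eqP ?].
split; [exact: hip_def|exact: hip_def|apply: hip_def].
by rewrite hipM starAK mulrC -hipM.
Qed.

Section Stages.
Variables (m00 m01 m10 m11 : alg G).

(* The last clause says that the matrix m S is symmetric on P. *)
Definition stage (P : K -> Prop) (p q s : alg G) :=
  [/\ scaled_unitary p q s, P 0, forall a b, P a -> P b -> P (a + b), forall A a, P a -> P (A a)
    & forall a, P a -> (m01 * starA p + m00 * q) a = (m10 * p + m11 * q) a].

(* Up to scaling S is the point of a sphere orthogonal to two real vectors; where their cross
   product vanishes, the next stage takes over. *)
Lemma three_stages : exists (P : nat -> K -> Prop) (p q s : nat -> alg G),
  [/\ forall k, (k < 3)%N -> stage (P k) (p k) (q k) (s k),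
     forall k l a, (k < l < 3)%N -> P l a -> s k a = 0 &
     forall z, (forall k a, (k < 3)%N -> P k a -> hip (s k a) z = 0) -> z = 0].
Proof.
(* Symmetry of m S reads al p* - be p - ga q = 0. For p = x + iy, q = iz it is orthogonality of (x,
   y, z) to Re w and Im w, where w = (al - be, -i(al + be), -i ga). The pair [p1], [q1] is the cross
   product of Im w and Re w; its third coordinate is [d]. *)
pose al := m01; pose be := m10; pose ga := m11 - m00.
pose d := al * starA al - be * starA be.
pose p1 := ii * (starA be * ga - al * starA ga).
pose q1 := ii * d.
have ds : starA d = d by rewrite /d starAD starAN !starAM !starAK [be * _]mulrC [al * _]mulrC.
have q1s : starA q1 = - q1 by rewrite /q1 starAM starA_ii ds; ring.
(* With q = 0 only al p* = be p remains. Where |al| = |be|, i.e. d = 0, p = i al (al - be)* solves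
   it. *)
pose p2 := ii * (al * starA al - al * starA be).
have [s1 s1s s1E] := alg_sqrt p1 q1.
have [s2 s2s s2E] := alg_sqrt p2 0.
have su1 : scaled_unitary p1 q1 s1 by split.
have su2 : scaled_unitary p2 0 s2 by split=> //; rewrite starA0 oppr0.
have su3 : scaled_unitary 1 0 1 by split; rewrite ?starA1 ?starA0 ?oppr0 // mulr0 addr0.
pose Q1 a := s1 a = 0; pose Q2 a := s1 a = 0 /\ s2 a = 0.
have dker a : Q1 a -> d a = 0.
  move=> /(scaled_unitary_ker su1)[_ qa _].
  have -> : d = - ii * q1 by rewrite /q1 mulrA mulNr ii2 opprK mul1r.
  by rewrite algME qa ap0.
have stage1 : stage (fun=> True) p1 q1 s1.
  split=> // a _; congr (aop _ a); apply/eqP; rewrite -subr_eq0; apply/eqP.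
  rewrite /p1 /q1 /d /al /be /ga !(starAM, starAD, starAN, starAK) starA_ii; ring.
have stage2 : stage Q1 p2 0 s2.
  have P0 : Q1 0 by exact: ap0.
  split=> //.
    by move=> a b h h'; rewrite /Q1 apD h h' addr0.
    by move=> A a h; rewrite /Q1 alg_comm h ap0.
  move=> a h; apply/eqP; rewrite -subr_eq0 -algBE.
  have -> : m01 * starA p2 + m00 * 0 - (m10 * p2 + m11 * 0) = (- ii * al) * d.
    rewrite /p2 /d /al /be !(starAM, starAD, starAN, starAK) starA_ii; ring.
  by rewrite algME dker // ap0.
have stage3 : stage Q2 1 0 1.
  have P0 : Q2 0 by split; apply: ap0.
  split=> //.
    by move=> a b [h1 h2] [h1' h2']; split; rewrite apD ?h1 ?h2 ?h1' ?h2' addr0.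
    by move=> A a [h h']; split; rewrite alg_comm ?h ?h' ap0.
  move=> a [h h']; rewrite starA1 !mulr1 !mulr0 !addr0.
  have [pa _ pa'] := scaled_unitary_ker su2 h'.
  apply/eqP; rewrite -subr_eq0 -algBE; apply/eqP/hip_def; rewrite hipM.
  (* This identity shows that al = be wherever [p2] and [d] both vanish, so the identity matrix
     serves as S there. *)
  have -> : starA (m01 - m10) * (m01 - m10) = - ii * p2 + ii * starA p2 - d.
    have -> : - ii * p2 = al * starA al - al * starA be.
      by rewrite /p2 mulrA mulNr ii2 opprK mul1r.
    have -> : ii * starA p2 = al * starA al - starA al * be.
      rewrite /p2 !(starAM, starAD, starAN, starAK) starA_ii mulrA mulrN ii2; ring.
    by rewrite /d /al /be !(starAM, starAD, starAN, starAK); ring.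
  by rewrite algBE algDE (algME (- ii)) pa (algME ii) pa' dker // !ap0 addr0 subr0 hip0l.
exists (fun k => match k with 0%N => fun=> True | 1%N => Q1 | _ => Q2 end),
  (fun k => match k with 0%N => p1 | 1%N => p2 | _ => 1 end),
  (fun k => match k with 0%N => q1 | 1%N => 0 | _ => 0 end),
  (fun k => match k with 0%N => s1 | 1%N => s2 | _ => 1 end).
split; first by case=> [|[|[|]]].
  move=> [|[|k]] [|[|[|l]]] a //=; rewrite ?andbF //; first by move=> _ [].
  by move=> _ [].
move=> z zP.
(* By self-adjointness, orthogonality to the vectors s a puts [z] in the kernel of s. Thus [z]
   passes the first two stages and lies in the domain of the third, where s = 1. *)
have z1 : s1 z = 0.
  by apply: hip_def; rewrite -{1}s1s hip_starl hip_conj (zP 0%N) ?conjC0.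
have z2 : s2 z = 0.
  apply: hip_def; rewrite -{1}s2s hip_starl hip_conj (zP 1%N) ?conjC0 //.
  by rewrite /Q1 alg_comm z1 ap0.
by apply: hip_def; have := zP 2%N z isT (conj z1 z2); rewrite alg1E.
Qed.

End Stages.

Variables (H : hilbert R) (u0 u1 : H -> K) (v : K -> K -> H) (T : H -> H).
Variables (n00 n01 n10 n11 : alg G).
Hypothesis hipu : forall x y : H, hip x y = hip (u0 x) (u0 y) + hip (u1 x) (u1 y).
Hypothesis u0v : forall a b, u0 (v a b) = a.
Hypothesis u1v : forall a b, u1 (v a b) = b.
Hypothesis u0T : forall x : H, u0 (T x) = n00 (u0 x) + n01 (u1 x).
Hypothesis u1T : forall x : H, u1 (T x) = n10 (u0 x) + n11 (u1 x).

Let H_eq (x y : H) : u0 x = u0 y -> u1 x = u1 y -> x = y.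
Proof. by move=> E0 E1; apply: hip_inj => z; rewrite !hipu E0 E1. Qed.

Lemma two_by_two_complex_symmetric : complex_symmetric T.
Proof.
have [J [Jc JJ Js JA]] := alg_conjugation G.
have JD x y : J (x + y) = J x + J y.
  by have := Jc.1 1 x y; rewrite conjC1 !scale1r.
pose m00 := starA n00; pose m01 := starA n01; pose m10 := starA n10; pose m11 := starA n11.
have [P [p [q [s [stP cross tot]]]]] := three_stages m00 m01 m10 m11.
(* The partial conjugation of stage k sends s (a, b) to J S (a, b), with S symmetric. *)
pose Dx (k : nat) a b : H := v (s k a) (s k b).
pose Dy k a b : H := v (J (p k a + q k b)) (J (q k a + starA (p k) b)).
pose D (x y : H) := exists k a b, [/\ (k < 3)%N, P k a, P k b, x = Dx k a b & y = Dy k a b].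
have J0 : J 0 = 0 by apply: (addrI (J 0)); rewrite -JD !addr0.
have Jpair A B x y : hip (J (A x)) (B y) = hip (J ((B * A) x)) y.
  by rewrite algME [in RHS]JA hip_starl.
have Jsym A x y : hip (J (A x)) y = hip (J (A y)) x.
  by rewrite JA hip_starl Js.
pose M k X := [\/ X = s k, X = p k, X = q k | X = starA (p k)].
have ker k l b X : (k < l < 3)%N -> P l b -> M k X -> X b = 0 /\ starA X b = 0.
  move=> kl Pb MX; have k3 : (k < 3)%N by case/andP: kl => /ltn_trans; apply.
  have sb := cross _ _ _ kl Pb; have [su _ _ _ _] := stP _ k3.
  have [pb qb pb'] := scaled_unitary_ker su sb; have [ss qs _] := su.
  by case: MX => ->; rewrite ?starAK ?ss ?qs ?algNE ?qb ?oppr0; split.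
(* The earlier stage's operators and their adjoints kill the domain of the later one. Both pairings
   vanish: the inner product serves isometry, the one through [J] serves symmetry. *)
have disj k l X Y a b : (k < 3)%N -> (l < 3)%N -> k <> l -> M k X -> M l Y -> P k a -> P l b ->
    hip (X a) (Y b) = 0 /\ hip (J (X a)) (Y b) = 0.
  move=> k3 l3 /eqP; rewrite neq_ltn => /orP[kl|kl] MX MY Pa Pb.
    have [|Xb Xb'] := ker k l b X _ Pb MX; first by rewrite kl.
    split; first by rewrite hip_star alg_comm Xb' ap0 hip0r.
    by rewrite Jpair Jsym algME Xb ap0 J0 hip0l.
  have [|Ya Ya'] := ker l k a Y _ Pa MY; first by rewrite kl.
  split; first by rewrite -hip_starl alg_comm Ya' ap0 hip0l.
  by rewrite Jpair mulrC algME Ya ap0 J0 hip0l.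
have Ms k : M k (s k) by constructor 1.
have Mp k : M k (p k) by constructor 2.
have Mq k : M k (q k) by constructor 3.
have Mp' k : M k (starA (p k)) by constructor 4.
have Dtot : total (fun x : H => exists y : H, D x y).
  move=> z zP; apply: hip_def; rewrite hipu.
  have sz k a : (k < 3)%N -> P k a -> hip (s k a) (u0 z) = 0 /\ hip (s k a) (u1 z) = 0.
    move=> k3 Pa; have [_ P0 _ _ _] := stP _ k3; split.
      have := zP (Dx k a 0); rewrite hipu u0v u1v ap0 hip0l addr0; apply.
      by exists (Dy k a 0), k, a, 0.
    have := zP (Dx k 0 a); rewrite hipu u0v u1v ap0 hip0l add0r; apply.
    by exists (Dy k 0 a), k, 0, a.
  have -> : u0 z = 0 by apply: tot => k a k3 Pa; have [] := sz k a k3 Pa.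
  have -> : u1 z = 0 by apply: tot => k a k3 Pa; have [] := sz k a k3 Pa.
  by rewrite hip0l addr0.
have D1 (x y x' y' : H) : D x y -> D x' y' -> hip y y' = hip x' x.
  move=> [k [a [b [k3 Pa Pb -> ->]]]] [l [c [e [l3 Pc Pe -> ->]]]].
  rewrite /Dx /Dy !hipu !u0v !u1v !JJ !(hipDl, hipDr).
  have [Ekl|kl] := pselect (k = l).
    subst l; have [[ss qs sE] _ _ _ _] := stP _ k3.
    rewrite !hipM !starAK ss qs sE qs !(mulNr, algDE, algNE, hipDl, hipNl).
    rewrite [q k * p k]mulrC [q k * starA (p k)]mulrC [p k * starA (p k)]mulrC; ring.
  have dj X Y f g : M l X -> M k Y -> P l f -> P k g -> hip (X f) (Y g) = 0.
    by move=> MX MY Pf Pg; have [] := disj l k X Y f g l3 k3 (nesym kl) MX MY Pf Pg.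
  by rewrite !dj // !addr0.
have D2 (x y x' y' : H) : D x y -> D x' y' -> hip y x' = hip y' x.
  move=> [k [a [b [k3 Pa Pb -> ->]]]] [l [c [e [l3 Pc Pe -> ->]]]].
  rewrite /Dx /Dy !hipu !u0v !u1v !JD !hipDl.
  have [Ekl|kl] := pselect (k = l).
    subst l; rewrite !Jpair.
    rewrite (Jsym _ c a) (Jsym _ e a) (Jsym _ c b) (Jsym _ e b); ring.
  have dj X Y f g : M k X -> M l Y -> P k f -> P l g -> hip (J (X f)) (Y g) = 0.
    by move=> MX MY Pf Pg; have [] := disj k l X Y f g k3 l3 kl MX MY Pf Pg.
  have dj' X Y f g : M l X -> M k Y -> P l f -> P k g -> hip (J (X f)) (Y g) = 0.
    by move=> MX MY Pf Pg; have [] := disj l k X Y f g l3 k3 (nesym kl) MX MY Pf Pg.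
  apply: (@etrans _ _ 0); first by rewrite !dj // !addr0.
  by rewrite !dj' // !addr0.
have [C [Cc CD _ Cs]] := conjugation_extension D1 D2 Dtot.
pose S (x : H) := v (m00 (u0 x) + m10 (u1 x)) (m01 (u0 x) + m11 (u1 x)).
have TS : is_adjoint T S.
  move=> x y; rewrite !hipu u0T u1T u0v u1v !hipDl !hipDr !hip_star; ring.
have ST : is_adjoint S T by move=> x y; rewrite hip_conj -TS -hip_conj.
have CS : forall x : H, C (S x) = T (C x).
  apply: (conjugation_intertwine Cs ST Dtot) => x [y [k [a [b [k3 Pa Pb -> _]]]]].
  have [_ _ PD PA c3] := stP _ k3.
  rewrite (CD (Dx k a b) (Dy k a b)); last by exists k, a, b.
  pose a' := m00 a + m10 b; pose b' := m01 a + m11 b.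
  (* [S] is the adjoint of T, with matrix m^t; its entries commute with s k, so it acts on the
     parameters (a, b). *)
  have -> : S (Dx k a b) = Dx k a' b'.
    by rewrite /S /Dx !u0v !u1v /a' /b' !apD !(alg_comm (s k)).
  rewrite (CD (Dx k a' b') (Dy k a' b')); last first.
    by exists k, a', b'; split=> //; apply: PD; apply: PA.
  have nJ (n : alg G) x1 : n (J x1) = J (starA n x1) by rewrite JA starAK.
  (* What remains is S m^t = m S for the stage matrix. Diagonal entries agree by commutativity, and
     the last clause of [stage] gives the others: at [b] in the first coordinate, at [a] in the
     second. *)
  apply: H_eq; rewrite ?u0T ?u1T /Dy !u0v !u1v !nJ -JD; congr J; rewrite -/m00 -/m01 -/m10 -/m11.
    apply: hip_inj => z; move: (congr1 (fun x => hip x z) (c3 b Pb)).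
    rewrite /a' /b' !(apD, algDE, algME, hipDl) !(alg_comm (q k)) !(alg_comm (p k)) => E.
    by apply/eqP; rewrite -subr_eq0 -(subrr (hip (m01 (starA (p k) b)) z + hip (m00 (q k b)) z)) {1}E; apply/eqP; ring.
  apply: hip_inj => z; move: (congr1 (fun x => hip x z) (c3 a Pa)).
  rewrite /a' /b' !(apD, algDE, algME, hipDl) !(alg_comm (q k)) !(alg_comm (starA (p k))) => E.
  by apply/eqP; rewrite -subr_eq0 -(subrr (hip (m01 (starA (p k) a)) z + hip (m00 (q k a)) z)) {2}E; apply/eqP; ring.
exists C; split=> //; exists S; split=> // x.
by rewrite CS Cc.2.2.
Qed.

End TwoByTwo.

(** * Binormal operators are complex symmetric *)

Lemma binormal_complex_symmetric (R : realType) (H : hilbert R) (T : H -> H) :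
  binormal T -> complex_symmetric T.
Proof.
move=> [K [U [N [Ulin [Uip [Usurj [Nnorm [Ncomm UT]]]]]]]].
have /choice[B BP] : forall ij : 'I_2 * 'I_2, exists b : bop K,
    (forall x, b x = N ij.1 ij.2 x) /\ (forall x, b (ad b x) = ad b (b x)).
  move=> [i j]; have [[_ Nbd] [S [adj NS]]] := Nnorm i j.
  by exists (Bop adj Nbd).
pose Gs (g : bop K) := exists ij, g = B ij \/ g = star (B ij).
have BB ij kl x : B ij (B kl x) = B kl (B ij x).
  by rewrite !(BP _).1 Ncomm.
(* The hypotheses relate an entry to the adjoint of the same entry only; Fuglede's theorem provides
   the mixed relations. *)
have BS ij kl x : B ij (star (B kl) x) = star (B kl) (B ij x).
  by apply: fuglede => [y|y]; [apply: (BP _).2|apply: BB].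
have SS ij kl x : star (B ij) (star (B kl) x) = star (B kl) (star (B ij) x).
  by apply: hip_inj => y; rewrite !hip_adl BB.
have Gcomm (g h : bop K) x : Gs g -> Gs h -> g (h x) = h (g x).
  move=> [ij [->|->]] [kl [->|->]]; [exact: BB|exact: BS| |exact: SS].
  exact/esym/BS.
have Gstar g : Gs g -> Gs (star g).
  move=> [ij [->|->]]; exists ij; first by right.
  by left; apply: bop_eq.
pose G := CommutingFamily Gcomm Gstar.
have GB ij : G (B ij) by exists ij; left.
pose i0 : 'I_2 := ord0; pose i1 : 'I_2 := lift ord0 ord0.
have /choice[v vP] : forall ab : K * K, exists x, U x i0 = ab.1 /\ U x i1 = ab.2.
  move=> [a b]; have [x xP] := Usurj (fun i => if i == i0 then a else b).
  by exists x; rewrite !xP.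
have sum2 (V : nmodType) (F : 'I_2 -> V) : \sum_(i < 2) F i = F i0 + F i1.
  by rewrite big_ord_recl big_ord1.
apply: (@two_by_two_complex_symmetric R K G H (fun x => U x i0) (fun x => U x i1)
  (fun a b => v (a, b)) T (alg_gen (GB (i0, i0))) (alg_gen (GB (i0, i1)))
  (alg_gen (GB (i1, i0))) (alg_gen (GB (i1, i1)))).
- by move=> x y; rewrite Uip sum2.
- by move=> a b; rewrite (vP (a, b)).1.
- by move=> a b; rewrite (vP (a, b)).2.
- by move=> x; rewrite UT sum2 /= !(BP _).1.
- by move=> x; rewrite UT sum2 /= !(BP _).1.
Qed.

(** * Finite-dimensional Hilbert spaces *)

Lemma real_cauchy (R : realType) (u : nat -> R) :
  (forall e, 0 < e -> exists N : nat, forall m n, (N <= m)%N -> (N <= n)%N -> `|u m - u n| < e) ->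
  exists l, forall e, 0 < e -> exists N : nat, forall n, (N <= n)%N -> `|u n - l| < e.
Proof.
(* The supremum of the eventual lower bounds is the limit inferior, which is the limit of a Cauchy
   sequence. *)
move=> uc; pose E : set R := fun t => exists N : nat, forall n, (N <= n)%N -> t <= u n.
have Eub N (e : R) : (forall m n, (N <= m)%N -> (N <= n)%N -> `|u m - u n| < e) ->
    ubound E (u N + e).
  move=> NP t [N' N'P]; have := N'P _ (leq_maxr N N'); move=> h; apply: (le_trans h).
  have := NP _ N (leq_maxl N N') (leqnn N); rewrite ltr_norml => /andP[_ /ltW].
  by rewrite lerBlDl.
have Elb N (e : R) : (forall m n, (N <= m)%N -> (N <= n)%N -> `|u m - u n| < e) -> E (u N - e).
  move=> NP; exists N => n Nn; have := NP _ _ Nn (leqnn N).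
  by rewrite ltr_norml => /andP[/ltW h _]; move: h; rewrite lerBrDl.
have sE : has_sup E.
  have [N NP] := uc 1 ltr01; split; first by exists (u N - 1); apply: Elb.
  by exists (u N + 1); apply: Eub.
exists (sup E) => e e0; have e2 : 0 < e / 2 by rewrite divr_gt0.
have [N NP] := uc _ e2; exists N => n Nn.
have NP' m k : (n <= m)%N -> (n <= k)%N -> `|u m - u k| < e / 2.
  by move=> nm nk; apply: NP; apply: (leq_trans Nn).
have h1 : sup E <= u n + e / 2 by apply: ge_sup; [exact: sE.1|exact: Eub].
have h2 : u n - e / 2 <= sup E by apply: ub_le_sup; [exact: sE.2|exact: Elb].
rewrite ltr_norml; apply/andP; split; lra.
Qed.

Lemma rat_dense (R : realType) (x d : R) : 0 < d -> exists q : rat, `|x - ratr q| < d.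
Proof.
move=> d0; have [|q] := @rat_in_itvoo R (x - d) (x + d); first by lra.
rewrite in_itv /= => /andP[h1 h2]; exists q; rewrite ltr_norml; apply/andP; split; lra.
Qed.

Section FiniteDimensional.
Variables (R : realType) (n : nat).
Implicit Types x y z : 'rV[R[i]]_n.

Definition rv_hip x y : R[i] := \sum_i x 0 i * (y 0 i)^*.
Let nrm x : R := Num.sqrt (complex.Re (rv_hip x x)).

Lemma rv_hip_linear (a : R[i]) x y z : rv_hip (a *: x + y) z = a * rv_hip x z + rv_hip y z.
Proof.
rewrite /rv_hip mulr_sumr -big_split; apply: eq_bigr => i _ /=.
by rewrite !mxE mulrDl mulrA.
Qed.

Lemma rv_hip_conj x y : rv_hip y x = (rv_hip x y)^*.
Proof.
rewrite /rv_hip rmorph_sum; apply: eq_bigr => i _.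
by rewrite rmorphM /= conjCK mulrC.
Qed.

Lemma rv_hip_sum x : rv_hip x x =
  (\sum_i (complex.Re (x 0 i) ^+ 2 + complex.Im (x 0 i) ^+ 2))%:C%C.
Proof.
rewrite [RHS](rmorph_sum (real_complex R)); apply: eq_bigr => i _.
by rewrite [RHS]add_Re2_Im2 normCK.
Qed.

Lemma rv_hip_ge0 x : 0 <= rv_hip x x.
Proof. by rewrite rv_hip_sum ler0c; apply: sumr_ge0 => i _; rewrite addr_ge0 ?sqr_ge0. Qed.

Lemma rv_hip_def x : rv_hip x x = 0 -> x = 0.
Proof.
move=> E; apply/rowP => i; rewrite mxE; apply/eqP; rewrite -normr_eq0 -sqrf_eq0 normCK.
have : rv_hip x x == 0 by apply/eqP.
rewrite /rv_hip psumr_eq0 => [/allP/(_ i)|j _]; last by rewrite -normCK exprn_ge0.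
by rewrite mem_index_enum => /(_ isT).
Qed.

Let coord_le x i : `|complex.Re (x 0 i)| <= nrm x /\ `|complex.Im (x 0 i)| <= nrm x.
Proof.
have s0 : 0 <= \sum_i (complex.Re (x 0 i) ^+ 2 + complex.Im (x 0 i) ^+ 2).
  by apply: sumr_ge0 => j _; rewrite addr_ge0 ?sqr_ge0.
have h : complex.Re (x 0 i) ^+ 2 + complex.Im (x 0 i) ^+ 2 <=
    \sum_i (complex.Re (x 0 i) ^+ 2 + complex.Im (x 0 i) ^+ 2).
  by rewrite [leRHS](bigD1 i) //= lerDl sumr_ge0 // => j _; rewrite addr_ge0 ?sqr_ge0.
by rewrite /nrm rv_hip_sum -2!sqrtr_sqr !ler_wsqrtr // (le_trans _ h) // ?lerDl ?lerDr sqr_ge0.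
Qed.

(** With d the coordinate bound, the squared norm is at most 2 n d^2, below 4 (n + 1)^2 d^2 = e^2;
    using n + 1 covers dimension 0. *)
Let nrm_lt x (e : R) : 0 < e ->
  (forall i, `|complex.Re (x 0 i)| < e / (2 * n.+1%:R) /\
     `|complex.Im (x 0 i)| < e / (2 * n.+1%:R)) -> nrm x < e.
Proof.
move=> e0; set d := e / _ => xP.
have d0 : 0 < d by rewrite divr_gt0 // mulr_gt0 // ltr0Sn.
rewrite /nrm rv_hip_sum /= -[ltRHS]gtr0_norm // -sqrtr_sqr ltr_sqrt ?exprn_gt0 //.
apply: (@le_lt_trans _ _ (\sum_(i < n) (2 * d ^+ 2))).
  apply: ler_sum => i _; have [/ltW h1 /ltW h2] := xP i.
  rewrite mulrDl mul1r -(real_normK (num_real (complex.Re _))).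
  rewrite -(real_normK (num_real (complex.Im _))).
  by apply: lerD; rewrite ler_sqr ?nnegrE // ltW.
have -> : \sum_(i < n) (2 * d ^+ 2) = n%:R * 2 * d ^+ 2.
  by rewrite sumr_const card_ord -mulrA [RHS]mulr_natl.
have -> : e = d * (2 * n.+1%:R) by rewrite /d divfK // mulf_neq0 // pnatr_eq0.
have -> : (d * (2 * n.+1%:R)) ^+ 2 = 4 * n.+1%:R ^+ 2 * d ^+ 2 by ring.
rewrite ltr_pM2r ?exprn_gt0 // -[n.+1%:R]natr1; have := ler0n R n.
move: (n%:R : R) => t t0; have := sqr_ge0 t.
have -> : 4 * (t + 1) ^+ 2 = 4 * t ^+ 2 + 8 * t + 4 by ring.
by move: (t ^+ 2) => *; lra.
Qed.

Lemma rv_hcomplete (u : nat -> 'rV[R[i]]_n) :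
  (forall e : R, 0 < e -> exists N : nat, forall m k : nat, (N <= m)%N -> (N <= k)%N ->
     nrm (u m - u k) < e) ->
  exists l, forall e : R, 0 < e -> exists N : nat, forall k : nat, (N <= k)%N -> nrm (u k - l) < e.
Proof.
move=> uc.
have /choice[f fP] : forall i, exists l : R[i], forall e : R, 0 < e ->
    exists N : nat, forall k, (N <= k)%N ->
      `|complex.Re (u k 0 i - l)| < e /\ `|complex.Im (u k 0 i - l)| < e.
  move=> i.
  have [a aP] : exists l, forall e, 0 < e -> exists N : nat, forall k, (N <= k)%N ->
      `|complex.Re (u k 0 i) - l| < e.
    apply: real_cauchy => e /uc[N NP]; exists N => m k Nm Nk.
    apply: le_lt_trans (NP _ _ Nm Nk); have [+ _] := coord_le (u m - u k) i.
    by rewrite !mxE; case: (u m 0 i) (u k 0 i) => [? ?] [? ?].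
  have [b bP] : exists l, forall e, 0 < e -> exists N : nat, forall k, (N <= k)%N ->
      `|complex.Im (u k 0 i) - l| < e.
    apply: real_cauchy => e /uc[N NP]; exists N => m k Nm Nk.
    apply: le_lt_trans (NP _ _ Nm Nk); have [_ +] := coord_le (u m - u k) i.
    by rewrite !mxE; case: (u m 0 i) (u k 0 i) => [? ?] [? ?].
  exists (a +i* b)%C => e e0; have [N NP] := aP e e0; have [N' NP'] := bP e e0.
  exists (maxn N N') => k; rewrite geq_max => /andP[/NP + /NP'].
  by case: (u k 0 i) => [? ?].
exists (\row_i f i) => e e0.
have d0 : 0 < e / (2 * n.+1%:R) by rewrite divr_gt0 // mulr_gt0 // ltr0Sn.
have /choice[g gP] := fun i => fP i _ d0.
exists (\max_i g i)%N => k gk; apply: nrm_lt => // i.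
rewrite !mxE; apply: gP; apply: leq_trans gk; exact: leq_bigmax.
Qed.

Lemma rv_hseparable : exists d : nat -> 'rV[R[i]]_n, forall x (e : R), 0 < e ->
  exists k : nat, nrm (x - d k) < e.
Proof.
pose row_of (q : 'rV[rat * rat]_n) : 'rV[R[i]]_n :=
  \row_i (ratr (q 0 i).1 +i* ratr (q 0 i).2)%C.
(* Rows with Gaussian rational coordinates are dense; numbers encoding no row are sent to 0. *)
exists (fun k => if unpickle k is Some q then row_of q else 0) => x e e0.
have d0 : 0 < e / (2 * n.+1%:R) by rewrite divr_gt0 // mulr_gt0 // ltr0Sn.
have /choice[q qP] : forall i, exists q : rat * rat,
    `|complex.Re (x 0 i) - ratr q.1| < e / (2 * n.+1%:R) /\
    `|complex.Im (x 0 i) - ratr q.2| < e / (2 * n.+1%:R).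
  move=> i; have [a aP] := rat_dense (complex.Re (x 0 i)) d0.
  by have [b bP] := rat_dense (complex.Im (x 0 i)) d0; exists (a, b).
exists (pickle (\row_i q i)); rewrite pickleK; apply: nrm_lt => // i.
by have := qP i; rewrite !mxE; case: (x 0 i) => [? ?].
Qed.

Definition rv_hilbert : hilbert R := @Hilbert R 'rV[R[i]]_n rv_hip
  rv_hip_linear rv_hip_conj rv_hip_ge0 rv_hip_def rv_hcomplete rv_hseparable.

Definition rv_basis (i : 'I_n) : rv_hilbert := delta_mx 0 i.

Lemma hip_basis (x : rv_hilbert) i : hip x (rv_basis i) = x 0 i.
Proof.
rewrite /= /rv_hip (bigD1 i) //= big1 ?addr0 => [|j ji]; rewrite mxE ?eqxx /= ?conjC1 ?mulr1 //.
by rewrite (negbTE ji) conjC0 mulr0.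
Qed.

Lemma hnorm_basis i : hnorm (rv_basis i) = 1.
Proof. by apply: hnorm2E => //; rewrite hip_basis mxE !eqxx expr1n. Qed.

End FiniteDimensional.

(** * An n-normal operator that is not complex symmetric, n >= 3 *)

Section Counterexample.
Variables (R : realType) (m : nat).
Let H := rv_hilbert R m.+3.
Let i0 : 'I_m.+3 := ord0.
Let i1 : 'I_m.+3 := @Ordinal m.+3 1 isT.
Let i2 : 'I_m.+3 := @Ordinal m.+3 2 isT.
Let e (i : 'I_m.+3) : H := rv_basis R i.
Implicit Types x y : H.

(* the weighted shift e2 |-> 2 e1, e1 |-> e0; equal weights would make it complex symmetric *)
Definition weighted_shift x : H := hip x (e i1) *: e i0 + (2 * hip x (e i2)) *: e i1.
Definition weighted_shift_adj x : H := hip x (e i0) *: e i1 + (2 * hip x (e i1)) *: e i2.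
Let T := weighted_shift.
Let S := weighted_shift_adj.

Let eE i j : hip (e i) (e j) = (i == j)%:R.
Proof. by rewrite hip_basis mxE eqxx eq_sym. Qed.

Let conj2 : (2 : R[i])^* = 2.
Proof. exact: conjC_nat. Qed.

Lemma weighted_shiftP : is_adjoint T S.
Proof.
move=> x y; rewrite /T /S /weighted_shift /weighted_shift_adj.
have cE a : (2 * a)^* = 2 * a^* :> R[i] by rewrite -{2}conj2; exact: rmorphM.
rewrite !(hipDl, hipDr, hipZl, hipZr) cE -!(hip_conj y); ring.
Qed.

Lemma weighted_shift_bop : is_bop T.
Proof.
split=> [a x y|].
  by apply: hip_inj => z; rewrite /T /weighted_shift !(hipDl, hipZl); ring.
exists 3 => x; rewrite (le_trans (hnormD _ _)) //.
have b a i (r : R) : `|a| <= r%:C%C -> hnorm (a *: e i) <= r.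
  by rewrite -lecR hnormZ hnorm_basis mulr1.
have c i : `|hip x (e i)| <= (hnorm x)%:C%C.
  by apply: (le_trans (hip_CS _ _)); rewrite hnorm_basis mulr1.
have -> : 3 * hnorm x = hnorm x + 2 * hnorm x by ring.
apply: lerD; first exact/b/c.
apply: b; rewrite normrM rmorphM normr_nat (rmorph_nat (real_complex R)).
by rewrite ler_pM2l ?ltr0n.
Qed.

(** On a one-dimensional space all operators are scalars, hence normal and commuting, so any n x n
    complex matrix is n-normal. *)
Lemma weighted_shift_normal : n_normal m.+3 T.
Proof.
pose t (i j : 'I_m.+3) : R[i] :=
  (i == i0)%:R * (j == i1)%:R + 2 * (i == i1)%:R * (j == i2)%:R.
exists (rv_hilbert R 1), (fun x i => const_mx (hip x (e i))), (fun i j z => t i j *: z).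
split; [|split; [|split; [|split; [|split]]]].
- by move=> a x y i; apply/matrixP => k l; rewrite !mxE hipDl hipZl.
- move=> x y; rewrite [LHS]/(rv_hip x y) /rv_hip; apply: eq_bigr => i _.
  by rewrite [RHS]/(rv_hip _ _) /rv_hip big_ord1 !mxE !hip_basis.
- move=> v; exists (\row_i v i 0 0) => i; apply/matrixP => k l.
  by rewrite [LHS]mxE hip_basis mxE !ord1.
- move=> i j; split.
    split; last exact: bop_cst_bnd.
    by move=> a x y; rewrite scalerDr !scalerA mulrC.
  exists (fun z => (t i j)^* *: z); split; first exact: bop_cst_adj.
  by move=> x; rewrite !scalerA mulrC.
- by move=> i j k l z; rewrite !scalerA mulrC.
move=> x i; apply/matrixP => k l; rewrite summxE !mxE.
under eq_bigr => j _ do rewrite !mxE /t mulrDl.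
have pick (c : R[i]) (f : 'I_m.+3 -> R[i]) j0 : \sum_j c * (j == j0)%:R * f j = c * f j0.
  rewrite (bigD1 j0) //= eqxx mulr1 big1 ?addr0 // => j /negbTE ->.
  by rewrite mulr0 mul0r.
rewrite big_split !pick /T /weighted_shift hipDl !hipZl !eE ![_ == i]eq_sym.
by congr (_ + _); [apply: mulrC|rewrite mulrAC].
Qed.

Lemma weighted_shift_not_complex_symmetric : ~ complex_symmetric T.
Proof.
move=> [C [[Clin [Cnorm CK]] [S' [adj TE]]]].
have S'E x : S' x = S x.
  apply: hip_inj => y; rewrite hip_conj [RHS]hip_conj; congr (_^*).
  by rewrite -adj weighted_shiftP.
have CT x : C (T x) = S (C x) by rewrite TE CK S'E.
have TC x : T (C x) = C (S x) by rewrite TE CK S'E.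
have CZ a x : C (a *: x) = a^* *: C x.
  have C0 : C 0 = 0 by apply: hnorm_eq0; rewrite Cnorm hnorm0.
  by have := Clin a x 0; rewrite C0 !addr0.
have S0 : S (e i0) = e i1.
  by rewrite /S /weighted_shift_adj !eE /= scale1r mulr0 scale0r addr0.
have S1 : S (e i1) = 2 *: e i2.
  by rewrite /S /weighted_shift_adj !eE /= scale0r mulr1 add0r.
have T2 : T (e i2) = 2 *: e i1.
  by rewrite /T /weighted_shift !eE /= scale0r mulr1 add0r.
have n2 : (2 : R[i]) != 0 by rewrite pnatr_eq0.
(* Here T^2 C e0 = C S^2 e0 = 2 C e2, and the range of T^2 is spanned by e0 whatever the
   dimension. *)
have [c Ec] : exists c, C (e i2) = c *: e i0.
  have : T (T (C (e i0))) = 2 *: C (e i2) by rewrite !TC S0 S1 CZ conj2.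
  set y := C (e i0); rewrite [T (T y)]/T {1}/weighted_shift.
  have -> : hip (T y) (e i2) = 0.
    by rewrite /T /weighted_shift hipDl !hipZl !eE /= !mulr0 addr0.
  rewrite mulr0 scale0r addr0 => E.
  exists (2^-1 * hip (T y) (e i1)).
  by rewrite -scalerA E scalerA mulVf // scale1r.
have SZ a x : S (a *: x) = a *: S x.
  by apply: hip_inj => z; rewrite /S /weighted_shift_adj !(hipDl, hipZl); ring.
(* Evaluating S C e2 = C T e2 gives norm |c| = 1 on the left, since S e0 = e1, and norm 2 on the
   right. *)
have E : c *: e i1 = 2 *: C (e i1).
  by rewrite -S0 -SZ -Ec -CT T2 CZ conj2 S0.
have c1 : `|c| = 1.
  by have := hnormZ c (e i0); rewrite -Ec Cnorm !hnorm_basis mulr1 => <-.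
have := hnormZ c (e i1); rewrite E hnormZ Cnorm !hnorm_basis c1 normr_nat !mulr1.
by move/eqP; rewrite -[1]/(1%:R) eqr_nat.
Qed.

End Counterexample.

Theorem theorem2p2 (R : realType) :
  (forall (H : hilbert R) (T : H -> H),
      is_bop T -> binormal T -> complex_symmetric T) /\
  (forall n : nat, (3 <= n)%N ->
      exists (H : hilbert R) (T : H -> H),
        is_bop T /\ n_normal n T /\ ~ complex_symmetric T).
Proof.
split=> [H T _|[|[|[|m]]] // _]; first exact: binormal_complex_symmetric.
exists (rv_hilbert R m.+3), (@weighted_shift R m); split; first exact: weighted_shift_bop.
split; [exact: weighted_shift_normal|exact: weighted_shift_not_complex_symmetric].
Qed.
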